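(* Let $X,U$ be Hilbert spaces. Assume that $A$ generates a strongly continuous semigroup $T(t)$ on $X$, $B\in\mathcal{B}(U,X_{-1})$, $F\in\mathcal{B}(X,U)$ is compact, and $\phi:X\to X$ satisfies $\phi(0)=0$ and $\|\phi(\xi_1)-\phi(\xi_2)\|\le L\|\xi_1-\xi_2\|$ for all $\xi_1,\xi_2\in X$, where $L\ge0$. Assume moreover that $\Delta_h$ is power stable for some $h>0$, i.e., there exist $\Omega\ge1$ and $\omega\in(0,1)$ such that $\|\Delta_h^k\|_{\mathcal{B}(X)}\le\Omega\omega^k$ for all $k\in\mathbb{N}_0$. Then the closed-loop system with the periodic event-triggering mechanism (described in the context) with parameters $h,\varepsilon,\ell_{\max}$ is exponentially stable for every $\ell_{\max}\in\mathbb{N}$ if $L,\varepsilon\ge0$ satisfy $$\varepsilon\Omega\big(\|S_hF\|_{\mathcal{B}(X)}+c_3(e^{c_2Lh}-1)\big)<1-\omega-c_1\Omega(e^{c_2Lh}-1),$$ where $$c_1:=\sup_{0\le\tau\le h}\|\Delta_\tau\|_{\mathcal{B}(X)},\quad c_2:=\sup_{0\le\tau\le h}\|T(\tau)\|_{\mathcal{B}(X)},\quad c_3:=\sup_{0\le\tau\le h}\|S_\tau F\|_{\mathcal{B}(X)}.$$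
   Context: $\mathcal{B}(Y,Z)$ is the space of bounded linear operators from $Y$ to $Z$, $\mathcal{B}(X)=\mathcal{B}(X,X)$, $\mathbb{N}=\{1,2,\dots\}$, $\mathbb{N}_0=\mathbb{N}\cup\{0\}$, and $\|\cdot\|$ is the norm of $X$. The extrapolation space $X_{-1}$ associated with $T(t)$ is the completion of $X$ with respect to the norm $\|x\|_{-1}:=\|(\lambda I-A)^{-1}x\|$, where $\lambda$ is a fixed element of the resolvent set of $A$. $T(t)$ extends to a strongly continuous semigroup on $X_{-1}$ whose generator is an extension of $A$ with domain $X$; the same symbols are used for the extensions. Operators: $S_\tau:=\int_0^\tau T(s)B\,ds$ and $\Delta_\tau:=T(\tau)+S_\tau F$. It is known that $S_\tau\in\mathcal{B}(U,X)$ for every $\tau\ge0$, with $\sup_{0\le t\le\tau}\|S_t\|_{\mathcal{B}(U,X)}<\infty$, so $\Delta_\tau\in\mathcal{B}(X)$. Closed-loop system: $\dot x(t)=Ax(t)+Bu(t)+\phi(x(t))$, $t\ge0$, $x(0)=x^0\in X$, with $u(t)=Fx(t_k)$ for $t_k\le t<t_{k+1}$, $k\in\mathbb{N}_0$. Its (mild) solution is the unique function $x\in C([0,\infty),X)$ with $x(0)=x^0$ and $$x(t_k+\tau)=T(\tau)x(t_k)+\int_0^\tau T(\tau-s)\big(BFx(t_k)+\phi(x(t_k+s))\big)ds$$ for all $\tau\in(0,t_{k+1}-t_k]$, $k\in\mathbb{N}_0$ (integral in $X_{-1}$). Periodic event-triggering mechanism with sampling period $h>0$, threshold $\varepsilon\ge0$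 and $\ell_{\max}\in\mathbb{N}$: $t_0:=0$, $t_{k+1}:=\min\{t_k+\ell_{\max}h,\bar t_{k+1}\}$, where $$\bar t_{k+1}:=\min\{\ell h>t_k:\|x(\ell h)-x(t_k)\|>\varepsilon\|x(t_k)\|,\ \ell\in\mathbb{N}\},\quad k\in\mathbb{N}_0$$ (with $\min\emptyset=\infty$). The times and the solution are generated recursively: in the definition of $\bar t_{k+1}$, $x(\ell h)$ for $\ell h>t_k$ is the value of the trajectory obtained by keeping the input $u=Fx(t_k)$ after $t_k$. Exponential stability of the closed-loop system: there exist constants $\Gamma_0\ge1$, $\gamma_0>0$ such that the solution satisfies $\|x(t)\|\le\Gamma_0e^{-\gamma_0t}\|x^0\|$ for all $x^0\in X$ and all $t\ge0$. *)

(* Defs.v *)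
From Stdlib Require Import Reals List.
From Coquelicot Require Import Coquelicot.
Open Scope R_scope.

(** * Scalars and Hilbert spaces *)

(* Hilbert spaces are taken over either of the two usual scalar fields. *)
Inductive scalar_field : Set := RealScalars | ComplexScalars.

Definition scalars (k : scalar_field) : AbsRing :=
  match k with
  | RealScalars => R_AbsRing
  | ComplexScalars => C_AbsRing
  end.

Definition of_real (k : scalar_field) : R -> scalars k :=
  match k return R -> scalars k with
  | RealScalars => fun r => r
  | ComplexScalars => RtoC
  end.

Definition conj (k : scalar_field) : scalars k -> scalars k :=
  match k return scalars k -> scalars k with
  | RealScalars => fun z => z
  | ComplexScalars => Cconj
  end.

Record HilbertSpace (k : scalar_field) : Type := {
  hs_space :> CompleteNormedModule (scalars k);
  inner : hs_space -> hs_space -> scalars k;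
  inner_plus_l : forall x y z : hs_space,
    inner (plus x y) z = plus (inner x z) (inner y z);
  inner_scal_l : forall (a : scalars k) (x y : hs_space),
    inner (scal a x) y = mult a (inner x y);
  inner_conj : forall x y : hs_space, inner y x = conj k (inner x y);
  inner_norm : forall x : hs_space, inner x x = of_real k (norm x ^ 2)
}.

(** * Restriction of scalars

    Coquelicot integrates functions with values in normed modules over [R]
    only; [realify V] is [V] with the same carrier, topology and norm, and
    scalars restricted to [R]. *)

Lemma of_real_one (k : scalar_field) : of_real k 1 = one.
Proof. destruct k; reflexivity. Qed.

Lemma of_real_plus (k : scalar_field) (a b : R) :
  of_real k (a + b) = plus (of_real k a) (of_real k b).
Proof. destruct k; [reflexivity | exact (RtoC_plus a b)]. Qed.

Lemma of_real_mult (k : scalar_field) (a b : R) :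
  of_real k (a * b) = mult (of_real k a) (of_real k b).
Proof. destruct k; [reflexivity | exact (RtoC_mult a b)]. Qed.

Lemma abs_of_real (k : scalar_field) (a : R) : abs (of_real k a) = Rabs a.
Proof. destruct k; [reflexivity | exact (Cmod_R a)]. Qed.

Definition real_scal {k : scalar_field} {V : ModuleSpace (scalars k)}
  (a : R) (x : V) : V := scal (of_real k a) x.

Lemma real_scal_assoc (k : scalar_field) (V : ModuleSpace (scalars k))
  (a b : R_AbsRing) (x : V) :
  real_scal a (real_scal b x) = real_scal (mult a b) x.
Proof.
  unfold real_scal; rewrite scal_assoc, <- of_real_mult; reflexivity.
Qed.

Lemma real_scal_one (k : scalar_field) (V : ModuleSpace (scalars k)) (x : V) :
  real_scal (@one R_AbsRing) x = x.
Proof.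
  unfold real_scal; change (@one R_AbsRing) with 1.
  rewrite of_real_one; apply scal_one.
Qed.

Lemma real_scal_distr_l (k : scalar_field) (V : ModuleSpace (scalars k))
  (a : R_AbsRing) (x y : V) :
  real_scal a (plus x y) = plus (real_scal a x) (real_scal a y).
Proof. exact (scal_distr_l (of_real k a) x y). Qed.

Lemma real_scal_distr_r (k : scalar_field) (V : ModuleSpace (scalars k))
  (a b : R_AbsRing) (x : V) :
  real_scal (plus a b) x = plus (real_scal a x) (real_scal b x).
Proof.
  unfold real_scal; change (plus a b) with (a + b).
  rewrite of_real_plus.
  exact (scal_distr_r (of_real k a) (of_real k b) x).
Qed.

Lemma norm_real_scal (k : scalar_field) (V : NormedModule (scalars k))
  (a : R_AbsRing) (x : V) : norm (real_scal a x) <= abs a * norm x.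
Proof.
  change (abs a) with (Rabs a); rewrite <- (abs_of_real k a).
  exact (norm_scal (of_real k a) x).
Qed.

Section Realify.
Context {k : scalar_field} (V : CompleteNormedModule (scalars k)).

Definition realify_ModuleSpace_class : ModuleSpace.class_of R_AbsRing V :=
  ModuleSpace.Class R_AbsRing V
    (AbelianGroup.class (CompleteNormedModule.AbelianGroup _ V))
    (ModuleSpace.Mixin R_AbsRing (CompleteNormedModule.AbelianGroup _ V)
       real_scal (real_scal_assoc k _) (real_scal_one k _)
       (real_scal_distr_l k _) (real_scal_distr_r k _)).

Definition realify_NormedModuleAux_class :
  NormedModuleAux.class_of R_AbsRing V :=
  NormedModuleAux.Class R_AbsRing V realify_ModuleSpace_class
    (UniformSpace.class (CompleteNormedModule.UniformSpace _ V)).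

Definition realify_NormedModule_class : NormedModule.class_of R_AbsRing V :=
  NormedModule.Class R_AbsRing V realify_NormedModuleAux_class
    (NormedModule.Mixin R_AbsRing
       (NormedModuleAux.Pack R_AbsRing V realify_NormedModuleAux_class V)
       (@norm _ V) (@norm_factor _ V) (@norm_triangle _ V)
       (norm_real_scal k V) (@norm_compat1 _ V) (@norm_compat2 _ V)
       (@norm_eq_zero _ V)).

Definition realify : CompleteNormedModule R_AbsRing :=
  CompleteNormedModule.Pack R_AbsRing V
    (CompleteNormedModule.Class R_AbsRing V realify_NormedModule_class
       (CompleteSpace.mixin _
          (CompleteSpace.class (CompleteNormedModule.CompleteSpace _ V))))
    V.

End Realify.

(* For a continuous integrand the Riemann integral is the Bochner integral. *)
Definition vec_RInt {k : scalar_field} {V : CompleteNormedModule (scalars k)}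
  (f : R -> V) (a b : R) : V := @RInt (realify V) f a b.

(** * Bounded and compact operators *)

(* [real] sends an infinite supremum to [0]; the supremum is finite exactly
   when [l] is bounded on the unit ball. *)
Definition op_norm {K : AbsRing} {V W : NormedModule K} (l : V -> W) : R :=
  real (Lub_Rbar (fun r => exists x : V, norm x <= 1 /\ r = norm (l x))).

(* [sup_op_norm G h] is the supremum of [op_norm (G tau)] over
   [0 <= tau <= h]; the same remark on [real] applies. *)
Definition sup_op_norm {K : AbsRing} {V W : NormedModule K}
  (G : R -> V -> W) (h : R) : R :=
  real (Lub_Rbar (fun r => exists tau, 0 <= tau <= h /\ r = op_norm (G tau))).

Definition closure {V : UniformSpace} (S : V -> Prop) (y : V) : Prop :=
  forall eps : posreal, exists x : V, S x /\ ball y eps x.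

Definition compact_set {V : UniformSpace} (S : V -> Prop) : Prop :=
  forall (I : Type) (O : I -> V -> Prop),
    (forall i, open (O i)) ->
    (forall x, S x -> exists i, O i x) ->
    exists s : list I, forall x, S x -> exists i, In i s /\ O i x.

Definition compact_operator {K : AbsRing} {V W : NormedModule K}
  (l : V -> W) : Prop :=
  is_linear l /\
  compact_set (closure (fun y : W => exists x : V, norm x <= 1 /\ y = l x)).

(** * Semigroups, generators, resolvents *)

(* Only the values [T t] with [0 <= t] are relevant. *)
Record C0_semigroup {K : AbsRing} {V : NormedModule K} (T : R -> V -> V)
  : Prop := {
  C0_linear : forall t, 0 <= t -> is_linear (T t);
  C0_zero : forall x, T 0 x = x;
  C0_plus : forall s t x, 0 <= s -> 0 <= t -> T (s + t) x = T s (T t x);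
  C0_continuous : forall x, filterlim (fun t => T t x) (at_right 0) (locally x)
}.

(* An operator with domain [dom]; the values of [app] outside [dom] are
   irrelevant. *)
Record partial_operator (V : Type) : Type := {
  dom : V -> Prop;
  app :> V -> V
}.
Arguments dom {V}.
Arguments app {V}.

Definition generates {k : scalar_field} {V : NormedModule (scalars k)}
  (A : partial_operator V) (T : R -> V -> V) : Prop :=
  C0_semigroup T /\
  forall x y : V, (dom A x /\ A x = y) <->
    filterlim (fun t => real_scal (/ t) (minus (T t x) x))
      (at_right 0) (locally y).

(* [iota P] is the element satisfying [P] when it exists and is unique. *)
Definition resolvent {K : AbsRing} {V : CompleteNormedModule K}
  (A : partial_operator V) (lambda : K) (x : V) : V :=
  iota (fun y : V => dom A y /\ minus (scal lambda y) (A y) = x).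

Definition resolvent_set {K : AbsRing} {V : CompleteNormedModule K}
  (A : partial_operator V) (lambda : K) : Prop :=
  (forall x : V, exists! y : V,
     dom A y /\ minus (scal lambda y) (A y) = x) /\
  is_linear (resolvent A lambda).

(** * Extrapolation space *)

(* [(X1, j)] is a completion of [X] for the norm [x |-> |(lambda - A)^-1 x|];
   [j] is the embedding of [X] into it. *)
Record is_extrapolation_space {K : AbsRing} {X X1 : CompleteNormedModule K}
  (A : partial_operator X) (lambda : K) (j : X -> X1) : Prop := {
  extra_plus : forall x y, j (plus x y) = plus (j x) (j y);
  extra_scal : forall (a : K) x, j (scal a x) = scal a (j x);
  extra_norm : forall x, norm (j x) = norm (resolvent A lambda x);
  extra_dense : forall (y : X1) (eps : posreal),
    exists x, norm (minus y (j x)) < eps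
}.

Definition extends_semigroup {K : AbsRing} {X X1 : CompleteNormedModule K}
  (j : X -> X1) (T : R -> X -> X) (T1 : R -> X1 -> X1) : Prop :=
  C0_semigroup T1 /\ forall t x, 0 <= t -> T1 t (j x) = j (T t x).

(** * The sampled-data closed loop *)

Section ClosedLoop.
Context {k : scalar_field} {X U X1 : CompleteNormedModule (scalars k)}.
Context (j : X -> X1) (T : R -> X -> X) (T1 : R -> X1 -> X1).
Context (B : U -> X1) (F : X -> U).

(* [S_tau u] is the integral of [T1 s (B u)], which lies in the range of [j],
   read as an element of [X]. *)
Definition S_op (tau : R) (u : U) : X :=
  iota (fun x : X => j x = vec_RInt (fun s => T1 s (B u)) 0 tau).

Definition SF_op (tau : R) (x : X) : X := S_op tau (F x).

Definition Delta_op (tau : R) (x : X) : X := plus (T tau x) (SF_op tau x).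

Context (phi : X -> X).

(* The variation-of-constants identity at time [s + tau], in [X1], when the
   input is held at the value [F (x s)] from time [s] on. *)
Definition held_input_formula (x : R -> X) (s tau : R) : Prop :=
  j (x (s + tau)) =
  plus (j (T tau (x s)))
    (vec_RInt (fun r => T1 (tau - r) (plus (B (F (x s))) (j (phi (x (s + r))))))
       0 tau).

(* [z] is the trajectory issued from [xi] at time [s] when the input [F xi] is
   kept for ever. *)
Definition held_trajectory (s : R) (xi : X) (z : R -> X) : Prop :=
  continuous_on (fun t => s <= t) z /\
  z s = xi /\
  forall tau, 0 < tau -> held_input_formula z s tau.

(* Minimum of a set of reals, with the convention that the minimum of the
   empty set is [p_infty]. *)
Definition is_min_Rbar (E : R -> Prop) (m : Rbar) : Prop :=
  match m with
  | Finite r => E r /\ forall y, E y -> r <= y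
  | p_infty => forall y, ~ E y
  | m_infty => False
  end.

Context (h eps : R) (lmax : nat).

(* [t'] is the update time following [tk] when the state at [tk] is [xi]. *)
Definition next_update (tk : R) (xi : X) (t' : R) : Prop :=
  exists (z : R -> X) (tbar : Rbar),
    held_trajectory tk xi z /\
    is_min_Rbar
      (fun s => exists l : nat, (1 <= l)%nat /\ s = INR l * h /\ tk < s /\
         norm (minus (z s) xi) > eps * norm xi) tbar /\
    Finite t' = Rbar_min (Finite (tk + INR lmax * h)) tbar.

Definition closed_loop_solution (x0 : X) (x : R -> X) : Prop :=
  continuous_on (fun t => 0 <= t) x /\
  x 0 = x0 /\
  exists t : nat -> R,
    t 0%nat = 0 /\
    (forall n, next_update (t n) (x (t n)) (t (S n))) /\
    forall n tau, 0 < tau <= t (S n) - t n -> held_input_formula x (t n) tau.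

Definition exponentially_stable : Prop :=
  exists Gamma0 gamma0 : R, 1 <= Gamma0 /\ 0 < gamma0 /\
    forall (x0 : X) (x : R -> X), closed_loop_solution x0 x ->
      forall t, 0 <= t -> norm (x t) <= Gamma0 * exp (- gamma0 * t) * norm x0.

End ClosedLoop.

(* Main.v *)
Require Import Defs.
From Stdlib Require Import Reals Lra Lia Classical ClassicalEpsilon.
From Coquelicot Require Import Coquelicot.
Open Scope R_scope.

(** Power stability of [Delta_h] says that the linear loop, with the input
    refreshed at every sampling time, contracts over one period in the norm
    [N x = sup_n |Delta_h^n x| / omega^n], which satisfies
    [|x| <= N x <= Omega |x|] ([adapted_norm_contraction]).  The event-triggered
    loop differs from it by two perturbations: the input is computed from the
    last transmitted sample [xi] instead of the current state, an error of
    norm at most [eps |xi|] by the triggering rule, and the nonlinearity [phi],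
    which Gronwall's inequality controls over one period by the factor
    [exp (c2 L h) - 1] ([norm_mild_le]).  Hence one period takes [N] of the
    state to at most [a N x + b N xi], where the smallness hypothesis is exactly
    [a + b < 1] ([adapted_norm_step]).  Between two updates [N] therefore stays
    below [N xi], and at the next update it is at most [rho N xi] with
    [rho = a + b] ([held_interval_decay]).  Updates are at most [lmax h] apart,
    so the decay is exponential in time ([sampled_loop_decay]).

    Two points of analysis come before this.  First, the constants [c1], [c2],
    [c3] and the operator norms bound the operators only if the
    suprema are finite: [T] is locally bounded by the uniform boundedness
    principle ([C0_bounded]), and [S_tau] maps into [X], with local bounds, by a
    density argument based on the resolvent identity for integrated orbits
    ([extrapolated_orbit_int_in_range]).  Second, the trajectory is given by an
    integral in the extrapolation space; it is rewritten as an identity in [X]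
    ([held_input_formula_mild]), after which the extrapolation space disappears.

    Integration forces real scalars, so complex spaces are replaced by their
    realifications; norms, topologies and the loop itself are the same. *)

(** * Norms and limits *)

(* The operations of a complete normed module are reached along several
   convertible coercion paths, which [lra] would treat as distinct terms. *)
Ltac unify_paths :=
  repeat match goal with
  | H : context [CompleteNormedModule.AbelianGroup ?K ?V] |- _ =>
      change (CompleteNormedModule.AbelianGroup K V) with
        (NormedModule.AbelianGroup K (CompleteNormedModule.NormedModule K V))
        in H
  | H : context [CompleteNormedModule.AbelianMonoid ?K ?V] |- _ =>
      change (CompleteNormedModule.AbelianMonoid K V) with
        (NormedModule.AbelianMonoid K (CompleteNormedModule.NormedModule K V))
        in H
  | H : context [CompleteNormedModule.ModuleSpace ?K ?V] |- _ =>
      change (CompleteNormedModule.ModuleSpace K V) with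
        (NormedModule.ModuleSpace K (CompleteNormedModule.NormedModule K V))
        in H
  | |- context [CompleteNormedModule.ModuleSpace ?K ?V] =>
      change (CompleteNormedModule.ModuleSpace K V) with
        (NormedModule.ModuleSpace K (CompleteNormedModule.NormedModule K V))
  | |- context [CompleteNormedModule.AbelianGroup ?K ?V] =>
      change (CompleteNormedModule.AbelianGroup K V) with
        (NormedModule.AbelianGroup K (CompleteNormedModule.NormedModule K V))
  | |- context [CompleteNormedModule.AbelianMonoid ?K ?V] =>
      change (CompleteNormedModule.AbelianMonoid K V) with
        (NormedModule.AbelianMonoid K (CompleteNormedModule.NormedModule K V))
  end.

Ltac nlra := unify_paths; lra.


Lemma plus_minus_l {K : AbsRing} {V : NormedModule K} (x y : V) :
  plus y (minus x y) = x.
Proof.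
  transitivity (plus (minus x y) y); [apply plus_comm |].
  transitivity (plus x (plus (opp y) y)); [symmetry; apply plus_assoc |].
  transitivity (plus x zero); [f_equal; exact (plus_opp_l (G := V) y) | apply plus_zero_r].
Qed.

Lemma minus_plus_l {K : AbsRing} {V : NormedModule K} (x y : V) :
  minus (plus x y) x = y.
Proof.
  transitivity (plus (plus y x) (opp x)).
  - apply (f_equal (fun z => plus z (opp x))), plus_comm.
  - transitivity (plus y (plus x (opp x))); [symmetry; apply plus_assoc |].
    transitivity (plus y zero); [f_equal; exact (plus_opp_r (G := V) x) | apply plus_zero_r].
Qed.

Lemma plus_plus_swap {G : AbelianMonoid} (a b c d : G) :
  plus (plus a b) (plus c d) = plus (plus a c) (plus b d).
Proof.
  rewrite <- !plus_assoc, (plus_assoc b), (plus_comm b), <- plus_assoc.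
  reflexivity.
Qed.

Lemma minus_plus_plus {K : AbsRing} {V : NormedModule K} (a b c d : V) :
  minus (plus a b) (plus c d) = plus (minus a c) (minus b d).
Proof.
  transitivity (plus (plus a b) (plus (opp c) (opp d))).
  - apply (f_equal (plus (plus a b))). exact (opp_plus (G := V) c d).
  - exact (plus_plus_swap (G := V) a b (opp c) (opp d)).
Qed.

Lemma norm_minus_sym {K : AbsRing} {V : NormedModule K} (x y : V) :
  norm (minus x y) = norm (minus y x).
Proof. now rewrite <- opp_minus, norm_opp. Qed.

Lemma norm_minus_self {K : AbsRing} {V : NormedModule K} (x : V) :
  norm (minus x x) = 0.
Proof.
  transitivity (norm (@zero V)); [| apply norm_zero].
  f_equal. exact (minus_eq_zero (G := V) x).
Qed.

Lemma norm_minus_trans {K : AbsRing} {V : NormedModule K} (x y z : V) :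
  norm (minus x z) <= norm (minus x y) + norm (minus y z).
Proof. rewrite (minus_trans y). apply norm_triangle. Qed.

Lemma norm_minus_le {K : AbsRing} {V : NormedModule K} (x y : V) :
  norm (minus x y) <= norm x + norm y.
Proof. rewrite <- (norm_opp y). apply (norm_triangle x (opp y)). Qed.

Lemma norm_le_minus {K : AbsRing} {V : NormedModule K} (x y : V) :
  norm x <= norm (minus x y) + norm y.
Proof.
  rewrite <- (minus_zero_r x) at 1. rewrite <- (minus_zero_r y) at 2.
  apply norm_minus_trans.
Qed.

Lemma norm_scal_le {V : NormedModule R_AbsRing} (a : R) (x : V) :
  norm (scal a x) <= Rabs a * norm x.
Proof. apply (norm_scal a x). Qed.

Lemma norm_minus_eq_0 {K : AbsRing} {V : NormedModule K} (x y : V) :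
  norm (minus x y) = 0 -> x = y.
Proof.
  intros H. rewrite <- (plus_minus_l x y).
  rewrite (norm_eq_zero _ H). apply plus_zero_r.
Qed.

Lemma filterlim_norm_minus {T : Type} {K : AbsRing} {V : NormedModule K}
  (F : (T -> Prop) -> Prop) {FF : Filter F} (f : T -> V) (l : V) :
  filterlim f F (locally l) <->
  forall eps, 0 < eps -> F (fun t => norm (minus (f t) l) < eps).
Proof.
  split.
  - intros H eps Heps.
    apply (H (fun y => norm (minus y l) < eps)), locally_le_locally_norm.
    exists (mkposreal eps Heps). easy.
  - intros H P HP. destruct (locally_norm_le_locally _ _ HP) as [d Hd].
    unfold filtermap. generalize (H d (cond_pos d)). apply filter_imp.
    intros t Ht. now apply Hd.
Qed.

Lemma continuous_norm {V : NormedModule R_AbsRing} (f : R -> V) (t : R) :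
  continuous f t <->
  forall eps, 0 < eps ->
    exists d, 0 < d /\
      forall s, Rabs (s - t) < d -> norm (minus (f s) (f t)) < eps.
Proof.
  etransitivity; [apply (filterlim_norm_minus (locally t) f (f t)) |]. split.
  - intros H eps Heps. destruct (H eps Heps) as [d Hd].
    exists d. split; [apply cond_pos | exact Hd].
  - intros H eps Heps. destruct (H eps Heps) as [d [Hd Hs]].
    exists (mkposreal d Hd). exact Hs.
Qed.

Lemma norm_lim_le {T : Type} {K : AbsRing} {V : NormedModule K}
  (F : (T -> Prop) -> Prop) {FF : ProperFilter F} (f : T -> V) (l a : V)
  (r : R) :
  filterlim f F (locally l) -> F (fun t => norm (minus (f t) a) <= r) ->
  norm (minus l a) <= r.
Proof.
  intros Hf Hr. apply le_epsilon. intros eps Heps.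
  apply filterlim_norm_minus with (eps := eps) in Hf; [| apply _ | exact Heps].
  destruct (filter_ex _ (filter_and _ _ Hf Hr)) as [t [H1 H2]].
  pose proof (norm_minus_trans l (f t) a).
  rewrite norm_minus_sym in H1. lra.
Qed.

Lemma cauchy_seq_cvg {K : AbsRing} {V : CompleteNormedModule K}
  (x : nat -> V) :
  (forall eps, 0 < eps ->
    exists N, forall n m, (N <= n)%nat -> (N <= m)%nat ->
      norm (minus (x n) (x m)) < eps) ->
  exists l, filterlim x eventually (locally l).
Proof.
  intros H. apply (proj1 (filterlim_locally_cauchy (U := V) (F := eventually) x)).
  intros eps.
  destruct (H eps (cond_pos eps)) as [N HN].
  exists (fun n => (N <= n)%nat). split.
  - now exists N.
  - intros n m Hn Hm. apply (norm_compat1 (V := V)). now apply HN.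
Qed.

Lemma continuous_Rmax_0 (t : R) : continuous (fun s => Rmax 0 s) t.
Proof.
  apply (continuous_norm (V := R_NormedModule)). intros eps Heps.
  exists eps. split; [exact Heps |]. intros s Hs.
  change (Rabs (Rmax 0 s - Rmax 0 t) < eps).
  revert Hs. unfold Rmax, Rabs.
  destruct (Rle_dec 0 s), (Rle_dec 0 t); repeat destruct Rcase_abs; lra.
Qed.

(** Clamping the time turns one-sided continuity at the left end of a half-line
    into continuity on the whole line, which integration lemmas ask for. *)
Lemma continuous_on_Rmax_0 {U : UniformSpace} (x : R -> U) (s : R) :
  continuous_on (fun t => s <= t) x ->
  forall r, continuous (fun r => x (s + Rmax 0 r)) r.
Proof.
  intros Hx r P HP.
  assert (Hs : s <= s + Rmax 0 r) by (pose proof (Rmax_l 0 r); lra).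
  specialize (Hx _ Hs P HP). unfold filtermap, within in Hx.
  assert (Hc : continuous (fun r => s + Rmax 0 r) r).
  { apply (continuous_plus (V := R_NormedModule) (fun _ => s)).
    - apply continuous_const.
    - apply continuous_Rmax_0. }
  specialize (Hc _ Hx). unfold filtermap in Hc |- *.
  revert Hc. apply filter_imp. intros r' H. apply H.
  pose proof (Rmax_l 0 r'). lra.
Qed.

(** * Integrals of continuous functions *)

(** Bounded linear maps commute with Riemann sums, hence with their limit. *)
Lemma RInt_linear {V W : CompleteNormedModule R_AbsRing} (l : V -> W)
  (f : R -> V) (a b : R) :
  is_linear l -> ex_RInt f a b ->
  RInt (fun t => l (f t)) a b = l (RInt f a b).
Proof.
  intros Hl Hf. apply is_RInt_unique.
  apply filterlim_ext with (f := fun ptd =>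
    l (scal (sign (b - a)) (Riemann_sum f ptd))).
  - intros ptd. rewrite (linear_scal _ Hl). f_equal.
    induction ptd as [x0 | p ptd IH] using SF_cons_ind.
    + exact (linear_zero _ Hl).
    + rewrite !Riemann_sum_cons, (linear_plus _ Hl), (linear_scal _ Hl), IH.
      reflexivity.
  - eapply filterlim_comp; [exact (RInt_correct _ _ _ Hf) |].
    exact (linear_cont (U := V) (V := W) l _ Hl).
Qed.

Lemma ex_RInt_cont {V : CompleteNormedModule R_AbsRing} (f : R -> V) (a b : R) :
  (forall t, continuous f t) -> ex_RInt f a b.
Proof. intros H. apply ex_RInt_continuous. auto. Qed.

Lemma RInt_shift {V : CompleteNormedModule R_AbsRing} (f : R -> V) (c a b : R) :
  (forall t, continuous f t) ->
  RInt (fun t => f (c + t)) a b = RInt f (c + a) (c + b).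
Proof.
  intros Hf. rewrite (Rplus_comm c a), (Rplus_comm c b).
  transitivity (RInt (fun t => scal 1 (f (1 * t + c))) a b).
  - apply RInt_ext. intros t _. rewrite (@scal_one R_AbsRing).
    f_equal. ring.
  - rewrite RInt_comp_lin by now apply ex_RInt_cont.
    now rewrite !Rmult_1_l.
Qed.

Lemma RInt_reflect {V : CompleteNormedModule R_AbsRing} (f : R -> V) (a : R) :
  (forall t, continuous f t) ->
  RInt (fun t => f (a - t)) 0 a = RInt f 0 a.
Proof.
  intros Hf.
  assert (Hc : forall t, continuous (fun t => f (a - t)) t).
  { intros t. apply (continuous_comp (fun t => a - t) f); [| apply Hf].
    apply (continuous_minus (V := R_NormedModule) (fun _ => a) (fun t => t)).
    - apply continuous_const.
    - apply continuous_id. }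
  rewrite <- (opp_opp (RInt (fun t => f (a - t)) 0 a)).
  rewrite <- RInt_opp by now apply ex_RInt_cont.
  transitivity (opp (RInt (fun t => scal (-1) (f (-1 * t + a))) 0 a)).
  - f_equal. apply RInt_ext. intros t _.
    replace (-1 * t + a) with (a - t) by ring. symmetry.
    exact (scal_opp_one (f (a - t))).
  - rewrite RInt_comp_lin by now apply ex_RInt_cont.
    replace (-1 * 0 + a) with a by ring.
    replace (-1 * a + a) with 0 by ring.
    apply opp_RInt_swap. now apply ex_RInt_cont.
Qed.

Lemma norm_RInt_cont_le {V : CompleteNormedModule R_AbsRing}
  (f : R -> V) (g : R -> R) (a b : R) :
  a <= b -> (forall t, continuous f t) -> (forall t, continuous g t) ->
  (forall t, a <= t <= b -> norm (f t) <= g t) ->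
  norm (RInt f a b) <= RInt g a b.
Proof.
  intros Hab Hf Hg Hfg.
  apply (norm_RInt_le f g a b); auto.
  - now apply RInt_correct, ex_RInt_cont.
  - now apply (RInt_correct (V := R_CompleteNormedModule)), ex_RInt_cont.
Qed.

Lemma is_derive_RInt_0 {V : CompleteNormedModule R_AbsRing} (f : R -> V) (t : R) :
  (forall s, continuous f s) -> is_derive (fun s => RInt f 0 s) t (f t).
Proof.
  intros Hf. apply (is_derive_RInt f _ 0); [| apply Hf].
  apply filter_forall. intros s. now apply RInt_correct, ex_RInt_cont.
Qed.

Lemma is_derive_norm {V : NormedModule R_AbsRing} (f : R -> V) (t : R) (l : V) :
  is_derive f t l -> forall eps, 0 < eps -> exists d, 0 < d /\
    forall s, Rabs s < d ->
      norm (minus (minus (f (t + s)) (f t)) (scal s l)) <= eps * Rabs s.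
Proof.
  intros [_ H] eps Heps.
  destruct (H t (fun P HP => HP) (mkposreal eps Heps)) as [d Hd].
  exists d. split; [apply cond_pos |]. intros s Hs.
  assert (Hts : t + s - t = s) by ring.
  assert (Hb : norm (minus (minus (f (t + s)) (f t)) (scal (t + s - t) l))
                 <= eps * Rabs (t + s - t)).
  { apply Hd. change (Rabs (t + s - t) < d). now rewrite Hts. }
  now rewrite Hts in Hb.
Qed.

(** The right-hand side of the integral inequality grows at rate at most [K]
    times itself, so its product with [exp (- K t)] decreases.  The conclusion
    bounds that right-hand side rather than [g], which gives both the bound on
    [g] and the bound [C (exp (K t) - 1)] on the integral term. *)
Lemma gronwall (g : R -> R) (C K a : R) :
  (forall t, continuous g t) -> 0 <= K ->
  (forall t, 0 <= t <= a -> g t <= C + K * RInt g 0 t) ->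
  forall t, 0 <= t <= a -> C + K * RInt g 0 t <= C * exp (K * t).
Proof.
  intros Hg HK Hle t Ht.
  pose (w := fun s => exp (- K * s) * (C + K * RInt g 0 s)).
  pose (dw := fun s => exp (- K * s) * (K * (g s - (C + K * RInt g 0 s)))).
  assert (Hw : forall s, is_derive w s (dw s)).
  { intros s. unfold w, dw.
    pose proof (is_derive_RInt_0 (V := R_CompleteNormedModule) g s Hg) as HI.
    evar_last.
    - apply (is_derive_mult (fun s => exp (- K * s))
               (fun s => C + K * RInt g 0 s)).
      + auto_derive; [exact I | reflexivity].
      + apply (is_derive_plus (fun _ => C) (fun s => K * RInt g 0 s)).
        * apply is_derive_const.
        * apply (is_derive_scal (fun s => RInt g 0 s)), HI.
      + intros n m. apply Rmult_comm.
    - unfold plus, mult, zero; simpl. unfold mult; simpl. ring. }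
  assert (Hdec : w t <= w 0).
  { destruct (Req_dec t 0) as [-> | Ht0]; [lra |].
    destruct (MVT_gen w 0 t dw) as [c [Hc E]].
    - intros s _. apply Hw.
    - intros s _. apply continuity_pt_filterlim, (ex_derive_continuous w).
      eexists. apply Hw.
    - rewrite Rmin_left, Rmax_right in Hc by lra.
      assert (dw c <= 0).
      { assert (Hd : g c - (C + K * RInt g 0 c) <= 0)
          by (apply Rle_minus, Hle; lra).
        pose proof (Rmult_le_compat_l K _ _ HK Hd) as Hd2.
        pose proof (Rmult_le_compat_l _ _ _ (Rlt_le _ _ (exp_pos (- K * c))) Hd2).
        unfold dw. lra. }
      assert (0 <= - dw c * (t - 0)) by (apply Rmult_le_pos; lra).
      lra. }
  unfold w in Hdec. rewrite RInt_point in Hdec.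
  change zero with 0 in Hdec.
  rewrite Rmult_0_r, exp_0, Rmult_0_r, Rplus_0_r, Rmult_1_l in Hdec.
  apply Rmult_le_compat_l with (r := exp (K * t)) in Hdec;
    [| left; apply exp_pos].
  rewrite <- Rmult_assoc, <- exp_plus in Hdec.
  replace (K * t + - K * t) with 0 in Hdec by ring.
  rewrite exp_0 in Hdec. lra.
Qed.

(** * Uniform boundedness *)

(** A family bounded by [K] on one ball is bounded on the whole space, by
    translation to the origin and scaling. *)
Lemma unbounded_on_balls {I : Type} {V W : NormedModule R_AbsRing}
  (l : I -> V -> W) :
  (forall i, is_linear (l i)) ->
  ~ (exists M, 0 < M /\ forall i x, norm (l i x) <= M * norm x) ->
  forall (x : V) (r K : R), 0 < r ->
    exists i y, norm (minus y x) <= r /\ K < norm (l i y).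
Proof.
  intros Hl Hunb x r K Hr. apply NNPP. intros Hno. apply Hunb.
  assert (Hball : forall i y, norm (minus y x) <= r -> norm (l i y) <= K).
  { intros i y Hy. apply Rnot_lt_le. intros HK. apply Hno. now exists i, y. }
  exists (2 * Rabs K / r + 1).
  assert (0 <= 2 * Rabs K / r).
  { apply Rmult_le_pos; [pose proof (Rabs_pos K); lra |].
    left. now apply Rinv_0_lt_compat. }
  split; [lra |]. intros i u.
  destruct (Req_dec (norm u) 0) as [Hu | Hu].
  { apply norm_eq_zero in Hu. rewrite Hu, (linear_zero _ (Hl i)), !norm_zero. lra. }
  assert (Hu0 : 0 < norm u) by (pose proof (norm_ge_0 u); lra).
  (* [u] is a multiple of a difference of two points of the ball. *)
  pose (v := scal (r / norm u) u).
  assert (Hv : norm v <= r).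
  { unfold v. eapply Rle_trans; [apply norm_scal_le |].
    rewrite Rabs_pos_eq.
    - right. field. lra.
    - left. now apply Rdiv_lt_0_compat. }
  assert (Hlv : norm (l i v) <= 2 * Rabs K).
  { rewrite <- (minus_plus_l x v), (linear_minus _ _ _ (Hl i)).
    eapply Rle_trans; [apply norm_minus_le |].
    assert (norm (l i (plus x v)) <= K)
      by (apply Hball; eapply Rle_trans; [| exact Hv];
          right; f_equal; apply minus_plus_l).
    assert (norm (l i x) <= K).
    { apply Hball. rewrite norm_minus_self. lra. }
    pose proof (Rle_abs K). lra. }
  assert (Huv : u = scal (norm u / r) v).
  { unfold v. rewrite scal_assoc.
    replace (mult (norm u / r) (r / norm u)) with (@one R_AbsRing).
    - now rewrite (@scal_one R_AbsRing).
    - unfold mult, one; simpl. field. lra. }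
  rewrite Huv at 1. rewrite (linear_scal _ (Hl i)).
  eapply Rle_trans; [apply norm_scal_le |].
  rewrite Rabs_pos_eq by (left; now apply Rdiv_lt_0_compat).
  apply Rle_trans with (norm u / r * (2 * Rabs K)).
  - apply Rmult_le_compat_l; [left; now apply Rdiv_lt_0_compat | exact Hlv].
  - replace (norm u / r * (2 * Rabs K)) with (2 * Rabs K / r * norm u)
      by (field; lra). lra.
Qed.

(** Banach--Steinhaus.  If no common bound existed, some operator would be
    large somewhere in every ball, hence on a smaller ball by continuity; nested
    balls on which some operator exceeds [n] shrink to a point at which the
    family is unbounded. *)
Lemma uniform_boundedness {I : Type} {V : CompleteNormedModule R_AbsRing}
  {W : NormedModule R_AbsRing} (l : I -> V -> W) :
  (forall i, is_linear (l i)) ->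
  (forall x, exists M, forall i, norm (l i x) <= M) ->
  exists M, 0 < M /\ forall i x, norm (l i x) <= M * norm x.
Proof.
  intros Hl Hpt. apply NNPP. intros Hunb.
  assert (Hstep : forall (n : nat) (c : V * posreal), exists c' : V * posreal,
    snd c' <= snd c / 2 /\
    (forall z, norm (minus z (fst c')) <= snd c' -> norm (minus z (fst c)) <= snd c) /\
    exists i, forall z, norm (minus z (fst c')) <= snd c' -> INR n < norm (l i z)).
  { intros n [x r]. pose proof (cond_pos r) as Hr.
    destruct (unbounded_on_balls l Hl Hunb x (r / 2) (INR n + 1) ltac:(lra))
      as [i [y [Hy HK]]].
    destruct (linear_norm _ (Hl i)) as [M [HM HMl]].
    assert (Hs : 0 < Rmin (r / 2) (/ M)).
    { apply Rmin_glb_lt; [lra | now apply Rinv_0_lt_compat]. }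
    exists (y, mkposreal _ Hs). simpl. split; [apply Rmin_l |]. split.
    - intros z Hz. pose proof (norm_minus_trans z y x).
      pose proof (Rmin_l (r / 2) (/ M)). nlra.
    - exists i. intros z Hz. specialize (HMl (minus y z)).
      rewrite (linear_minus _ _ _ (Hl i)) in HMl.
      pose proof (norm_le_minus (l i y) (l i z)).
      assert (M * norm (minus y z) <= 1).
      { rewrite norm_minus_sym. rewrite <- (Rinv_r M) by lra.
        apply Rmult_le_compat_l; [lra |].
        eapply Rle_trans; [exact Hz | apply Rmin_r]. }
      nlra. }
  (* [c n] is the centre and radius of the n-th ball. *)
  pose (step := fun n c => proj1_sig
    (constructive_indefinite_description _ (Hstep n c))).
  pose (c := nat_rect (fun _ => (V * posreal)%type)
    (zero, mkposreal 1 Rlt_0_1) step).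
  assert (Hc : forall n,
    snd (c (S n)) <= snd (c n) / 2 /\
    (forall z, norm (minus z (fst (c (S n)))) <= snd (c (S n)) ->
       norm (minus z (fst (c n))) <= snd (c n)) /\
    exists i, forall z, norm (minus z (fst (c (S n)))) <= snd (c (S n)) ->
       INR n < norm (l i z)).
  { intros n. exact (proj2_sig (constructive_indefinite_description _
      (Hstep n (c n)))). }
  assert (Hr : forall n, snd (c n) <= (/ 2) ^ n).
  { induction n as [| n IH]; [simpl; lra |].
    destruct (Hc n) as [H _].
    change ((/ 2) ^ S n) with (/ 2 * (/ 2) ^ n). lra. }
  assert (Hnest : forall n m, (n <= m)%nat ->
    norm (minus (fst (c m)) (fst (c n))) <= snd (c n)).
  { intros n m Hnm.
    assert (Hz : forall z, norm (minus z (fst (c m))) <= snd (c m) ->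
      norm (minus z (fst (c n))) <= snd (c n)).
    { induction Hnm as [| m Hnm IH]; [auto |].
      intros z Hz. apply IH. destruct (Hc m) as [_ [H _]]. now apply H. }
    apply Hz. unify_paths. rewrite norm_minus_self. apply Rlt_le, cond_pos. }
  destruct (cauchy_seq_cvg (fun n => fst (c n))) as [x Hx].
  { intros eps Heps.
    destruct (pow_lt_1_zero (/ 2) ltac:(rewrite Rabs_pos_eq; lra) (eps / 2) ltac:(lra))
      as [N HN].
    exists N. intros n m Hn Hm.
    specialize (HN N (Nat.le_refl N)). rewrite Rabs_pos_eq in HN
      by (apply pow_le; lra).
    pose proof (Hnest N n Hn). pose proof (Hnest N m Hm). pose proof (Hr N).
    pose proof (norm_minus_trans (fst (c n)) (fst (c N)) (fst (c m))) as H2.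
    rewrite (norm_minus_sym (fst (c N)) (fst (c m))) in H2. nlra. }
  assert (Hxn : forall n, norm (minus x (fst (c n))) <= snd (c n)).
  { intros n. apply (norm_lim_le eventually (fun n => fst (c n))); [exact Hx |].
    exists n. intros m Hm. now apply Hnest. }
  destruct (Hpt x) as [M HM].
  destruct (INR_unbounded M) as [n Hn].
  destruct (Hc n) as [_ [_ [i Hi]]].
  specialize (Hi x (Hxn (S n))). specialize (HM i). lra.
Qed.

(** * Strongly continuous semigroups *)

Section Semigroup.
Context {V : CompleteNormedModule R_AbsRing} (T : R -> V -> V).
Context (HT : C0_semigroup T).

Lemma C0_near_0 (x : V) (eps : R) : 0 < eps ->
  exists d, 0 < d /\ forall t, 0 <= t < d -> norm (minus (T t x) x) < eps.
Proof.
  intros Heps. pose proof (C0_continuous T HT x) as H.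
  apply filterlim_norm_minus with (eps := eps) in H; [| apply _ | exact Heps].
  destruct H as [d Hd]. exists d. split; [apply cond_pos |].
  intros t Ht. destruct (Req_dec t 0) as [-> | Ht0].
  - rewrite (C0_zero T HT). unify_paths. now rewrite norm_minus_self.
  - apply Hd; [| lra]. change (Rabs (t - 0) < d). rewrite Rabs_pos_eq; lra.
Qed.

(** Otherwise some [T t_n] with [t_n <= 1 / (n + 1)] have norms above [n], although
    [T t_n x] converges to [x] for every [x]: this contradicts uniform
    boundedness. *)
Lemma C0_bounded_near_0 :
  exists d M, 0 < d /\ forall t x, 0 <= t <= d -> norm (T t x) <= M * norm x.
Proof.
  apply NNPP. intros Hno.
  assert (Hbad : forall n : nat, exists t, 0 <= t <= / (INR n + 1) /\
    exists x, INR n * norm x < norm (T t x)).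
  { intros n. apply NNPP. intros H. apply Hno.
    exists (/ (INR n + 1)), (INR n). split.
    - apply Rinv_0_lt_compat. pose proof (pos_INR n). lra.
    - intros t x Ht. apply Rnot_lt_le. intros Hx. apply H.
      exists t. split; [exact Ht | now exists x]. }
  pose (t := fun n => proj1_sig (constructive_indefinite_description _ (Hbad n))).
  assert (Ht : forall n, 0 <= t n <= / (INR n + 1) /\
    exists x, INR n * norm x < norm (T (t n) x)).
  { intros n. exact (proj2_sig (constructive_indefinite_description _ (Hbad n))). }
  destruct (uniform_boundedness (fun n => T (t n))) as [M [HM HMT]].
  - intros n. apply (C0_linear T HT), Ht.
  - intros x.
    destruct (filterlim_bounded (fun n => T (t n) x)) as [M HM].
    + exists x. apply filterlim_norm_minus; [apply _ |]. intros eps Heps.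
      destruct (C0_near_0 x eps Heps) as [d [Hd Hdx]].
      destruct (INR_unbounded (/ d)) as [N HN]. exists N. intros n Hn.
      apply Hdx. split; [apply Ht |]. eapply Rle_lt_trans; [apply Ht |].
      rewrite <- (Rinv_inv d). apply le_INR in Hn.
      pose proof (Rinv_0_lt_compat d Hd).
      apply Rinv_lt_contravar; [apply Rmult_lt_0_compat |]; lra.
    + now exists M.
  - destruct (INR_unbounded M) as [n Hn]. destruct (Ht n) as [_ [x Hx]].
    specialize (HMT n x). pose proof (norm_ge_0 x).
    assert (M * norm x <= INR n * norm x) by (apply Rmult_le_compat_r; lra).
    lra.
Qed.

Lemma C0_bounded (a : R) :
  exists M, 1 <= M /\ forall t x, 0 <= t <= a -> norm (T t x) <= M * norm x.
Proof.
  destruct C0_bounded_near_0 as [d [M0 [Hd HM0]]].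
  set (M := Rmax 1 M0).
  assert (HM : forall t x, 0 <= t <= d -> norm (T t x) <= M * norm x).
  { intros t x Ht. eapply Rle_trans; [now apply HM0 |].
    apply Rmult_le_compat_r; [apply norm_ge_0 | apply Rmax_r]. }
  assert (HM1 : 1 <= M) by apply Rmax_l.
  assert (Hn : forall n t x, 0 <= t <= INR n * d ->
    norm (T t x) <= M ^ S n * norm x).
  { induction n as [| n IH]; intros t x Ht.
    - simpl in *. rewrite Rmult_1_r. apply HM. lra.
    - rewrite S_INR in Ht. destruct (Rle_dec t d) as [Htd | Htd].
      + eapply Rle_trans; [apply HM; lra |].
        apply Rmult_le_compat_r; [apply norm_ge_0 |].
        rewrite <- (pow_1 M) at 1. apply Rle_pow; [exact HM1 | lia].
      + replace t with (d + (t - d)) by ring.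
        rewrite (C0_plus T HT) by lra.
        eapply Rle_trans; [apply HM; lra |].
        change (M ^ S (S n)) with (M * M ^ S n). rewrite Rmult_assoc.
        apply Rmult_le_compat_l; [lra |]. apply IH. lra. }
  destruct (INR_unbounded (a / d)) as [n Hna].
  exists (M ^ S n). split; [apply pow_R1_Rle, HM1 |].
  intros t x Ht. apply Hn. split; [lra |].
  apply Rle_trans with a; [lra |]. apply Rmult_lt_compat_r with (r := d) in Hna;
    [| exact Hd]. replace (a / d * d) with a in Hna by (field; lra). lra.
Qed.

(** The semigroup law reduces continuity at any time to continuity at [0]. *)
Lemma C0_modulus (a M : R) :
  (forall t x, 0 <= t <= a -> norm (T t x) <= M * norm x) ->
  forall s t x, 0 <= s <= a -> 0 <= t <= a ->
    norm (minus (T s x) (T t x)) <= M * norm (minus (T (Rabs (s - t)) x) x).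
Proof.
  intros HM.
  assert (Hle : forall s t x, 0 <= t <= s -> s <= a ->
    norm (minus (T s x) (T t x)) <= M * norm (minus (T (Rabs (s - t)) x) x)).
  { intros s t x Hts Hs. rewrite Rabs_pos_eq by lra.
    replace s with (t + (s - t)) at 1 by ring.
    rewrite (C0_plus T HT) by lra.
    assert (Hlin : is_linear (T t)) by (apply (C0_linear T HT); lra).
    rewrite <- (linear_minus _ _ _ Hlin). apply HM. lra. }
  intros s t x Hs Ht. destruct (Rle_dec t s) as [H | H].
  - apply Hle; lra.
  - unify_paths. rewrite norm_minus_sym, Rabs_minus_sym. apply Hle; lra.
Qed.

(** Clamping the time at [0] makes the orbit a function on the whole line to
    which two-sided continuity and integration apply. *)
Lemma C0_continuous_comp (u : R -> R) (f : R -> V) (r : R) :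
  continuous u r -> continuous f r ->
  continuous (fun s => T (Rmax 0 (u s)) (f s)) r.
Proof.
  intros Hu Hf.
  apply (continuous_norm (V := V) (fun s => T (Rmax 0 (u s)) (f s)) r).
  intros eps Heps.
  set (a := Rmax 0 (u r) + 1).
  destruct (C0_bounded a) as [M [HM1 HM]].
  assert (He : 0 < eps / (2 * M)) by (apply Rdiv_lt_0_compat; lra).
  destruct (C0_near_0 (f r) _ He) as [d [Hd Hdx]].
  destruct (proj1 (continuous_norm f r) Hf _ He) as [d1 [Hd1 Hf1]].
  assert (Hcl : continuous (fun s => Rmax 0 (u s)) r).
  { apply (continuous_comp u (fun s => Rmax 0 s) r Hu), continuous_Rmax_0. }
  destruct (proj1 (continuous_norm (V := R_NormedModule) _ r) Hcl (Rmin d 1))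
    as [d2 [Hd2 Hu2]]; [apply Rmin_glb_lt; lra |].
  exists (Rmin d1 d2). split; [apply Rmin_glb_lt; lra |]. intros s Hs.
  specialize (Hf1 s (Rlt_le_trans _ _ _ Hs (Rmin_l _ _))).
  specialize (Hu2 s (Rlt_le_trans _ _ _ Hs (Rmin_r _ _))).
  change (Rabs (Rmax 0 (u s) - Rmax 0 (u r)) < Rmin d 1) in Hu2.
  pose proof (Rmin_l d 1). pose proof (Rmin_r d 1).
  pose proof (Rmax_l 0 (u s)) as Hps. pose proof (Rmax_l 0 (u r)) as Hpr.
  assert (Hsa : Rmax 0 (u s) <= a).
  { unfold a. pose proof (Rle_abs (Rmax 0 (u s) - Rmax 0 (u r))). lra. }
  assert (Hra : Rmax 0 (u r) <= a) by (unfold a; lra).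
  eapply Rle_lt_trans;
    [apply (norm_minus_trans _ (T (Rmax 0 (u s)) (f r))) |].
  rewrite <- (linear_minus _ _ _ (C0_linear T HT _ Hps)).
  assert (H1 : norm (T (Rmax 0 (u s)) (minus (f s) (f r))) < eps / 2).
  { eapply Rle_lt_trans; [apply HM; lra |].
    replace (eps / 2) with (M * (eps / (2 * M))) by (field; lra).
    apply Rmult_lt_compat_l; nlra. }
  assert (H2 : norm (minus (T (Rmax 0 (u s)) (f r)) (T (Rmax 0 (u r)) (f r)))
    < eps / 2).
  { eapply Rle_lt_trans; [apply (C0_modulus a M HM); lra |].
    replace (eps / 2) with (M * (eps / (2 * M))) by (field; lra).
    apply Rmult_lt_compat_l; [lra |]. apply Hdx.
    split; [apply Rabs_pos | lra]. }
  nlra.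
Qed.

Lemma C0_orbit_continuous (x : V) (t : R) :
  continuous (fun s => T (Rmax 0 s) x) t.
Proof.
  apply (C0_continuous_comp (fun s => s) (fun _ => x)).
  - apply continuous_id.
  - apply continuous_const.
Qed.

(** The clamp is inactive on the interval of integration; it makes the integrand
    continuous on the whole line. *)
Definition conv (f : R -> V) (t : R) : V :=
  RInt (fun r => T (Rmax 0 (t - r)) (f r)) 0 t.

Lemma conv_integrand_continuous (f : R -> V) (t : R) :
  (forall r, continuous f r) ->
  forall r, continuous (fun r => T (Rmax 0 (t - r)) (f r)) r.
Proof.
  intros Hf r. apply (C0_continuous_comp (fun r => t - r) f); [| apply Hf].
  apply (continuous_minus (V := R_NormedModule) (fun _ => t) (fun r => r)).
  - apply continuous_const.
  - apply continuous_id.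
Qed.

(** The semigroup law for convolutions: the past up to [s] enters only through
    its convolution at time [s]. *)
Lemma conv_split (f : R -> V) (s t : R) :
  (forall r, continuous f r) -> 0 <= s -> 0 <= t ->
  conv f (s + t) = plus (T t (conv f s)) (conv (fun r => f (s + r)) t).
Proof.
  intros Hf Hs Ht. unfold conv.
  pose proof (conv_integrand_continuous f (s + t) Hf) as Hc.
  rewrite <- (RInt_Chasles _ 0 s (s + t)) by now apply ex_RInt_cont.
  f_equal.
  - rewrite <- (RInt_linear (T t)).
    + apply RInt_ext. intros r. rewrite Rmin_left, Rmax_right by lra. intros Hr.
      rewrite <- (C0_plus T HT) by (try apply Rmax_l; lra).
      f_equal. rewrite !Rmax_right by lra. ring.
    + now apply (C0_linear T HT).
    + now apply ex_RInt_cont, conv_integrand_continuous.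
  - pose proof (RInt_shift _ s 0 t Hc) as E. rewrite Rplus_0_r in E.
    etransitivity; [exact (eq_sym E) |].
    apply RInt_ext. intros r _. do 2 f_equal. ring.
Qed.

Lemma conv_minus (f g : R -> V) (t : R) :
  (forall r, continuous f r) -> (forall r, continuous g r) ->
  minus (conv f t) (conv g t) = conv (fun r => minus (f r) (g r)) t.
Proof.
  intros Hf Hg. unfold conv. rewrite <- RInt_minus
    by now apply ex_RInt_cont, conv_integrand_continuous.
  apply RInt_ext. intros r _. symmetry.
  exact (linear_minus _ _ _ (C0_linear T HT _ (Rmax_l _ _))).
Qed.

Lemma norm_conv_le (f : R -> V) (g : R -> R) (M a t : R) :
  (forall s x, 0 <= s <= a -> norm (T s x) <= M * norm x) ->
  (forall r, continuous f r) -> (forall r, continuous g r) ->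
  0 <= M -> 0 <= t <= a -> (forall r, 0 <= r <= t -> norm (f r) <= g r) ->
  norm (conv f t) <= M * RInt g 0 t.
Proof.
  intros HM Hf Hg HM0 Ht Hfg.
  rewrite <- (RInt_scal (V := R_CompleteNormedModule)) by now apply ex_RInt_cont.
  apply norm_RInt_cont_le.
  - lra.
  - now apply conv_integrand_continuous.
  - intros r. apply (continuous_scal_r (V := R_NormedModule) M), Hg.
  - intros r Hr. rewrite Rmax_right by lra.
    eapply Rle_trans; [apply HM; lra |].
    apply Rmult_le_compat_l; [exact HM0 |]. now apply Hfg.
Qed.

Definition orbit_int (t : R) (x : V) : V :=
  RInt (fun s => T (Rmax 0 s) x) 0 t.

Lemma ex_RInt_orbit (x : V) (a b : R) :
  ex_RInt (fun s => T (Rmax 0 s) x) a b.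
Proof. apply ex_RInt_cont, C0_orbit_continuous. Qed.

Lemma norm_orbit_int_le (a M : R) :
  (forall s x, 0 <= s <= a -> norm (T s x) <= M * norm x) ->
  forall t x, 0 <= t <= a -> norm (orbit_int t x) <= t * (M * norm x).
Proof.
  intros HM t x Ht.
  assert (E : RInt (fun _ => M * norm x) 0 t = t * (M * norm x)).
  { rewrite RInt_const. unfold scal; simpl. unfold mult; simpl. ring. }
  rewrite <- E. apply norm_RInt_cont_le.
  - lra.
  - apply C0_orbit_continuous.
  - intros s. apply continuous_const.
  - intros s Hs. apply HM. rewrite Rmax_right; lra.
Qed.

Lemma orbit_int_linear (t : R) : 0 <= t -> is_linear (orbit_int t).
Proof.
  intros Ht. destruct (C0_bounded t) as [M [HM1 HM]]. split.
  - intros x y. unfold orbit_int.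
    etransitivity; [| apply RInt_plus; apply ex_RInt_orbit].
    apply RInt_ext. intros s _. exact (linear_plus _ (C0_linear T HT _ (Rmax_l _ _)) x y).
  - intros a x. unfold orbit_int.
    etransitivity; [| apply RInt_scal, ex_RInt_orbit].
    apply RInt_ext. intros s _. exact (linear_scal _ (C0_linear T HT _ (Rmax_l _ _)) a x).
  - exists (t * M + 1). assert (0 <= t * M) by (apply Rmult_le_pos; lra).
    split; [lra |]. intros x.
    eapply Rle_trans; [apply (norm_orbit_int_le t M HM); lra |].
    pose proof (norm_ge_0 x). nra.
Qed.

Lemma orbit_int_plus (s t : R) (x : V) : 0 <= s -> 0 <= t ->
  orbit_int (s + t) x = plus (T t (orbit_int s x)) (orbit_int t x).
Proof.
  intros Hs Ht. unfold orbit_int. rewrite (Rplus_comm s t).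
  rewrite <- (RInt_Chasles _ 0 t (t + s)) by apply ex_RInt_orbit.
  rewrite plus_comm. f_equal.
  rewrite <- (RInt_linear (T t)); [| now apply (C0_linear T HT) | apply ex_RInt_orbit].
  pose proof (RInt_shift _ t 0 s (C0_orbit_continuous x)) as E.
  rewrite Rplus_0_r in E. etransitivity; [exact (eq_sym E) |].
  apply RInt_ext. intros r. rewrite Rmin_left, Rmax_right by lra. intros Hr.
  rewrite <- (C0_plus T HT) by (try apply Rmax_l; lra).
  f_equal. rewrite !Rmax_right by lra. reflexivity.
Qed.

(** The increment of [T] on [int_0^t T(s) x ds] is the derivative at [0] of
    [int_r^(t + r) T(s) x ds]. *)
Lemma orbit_int_generator (t : R) (x : V) : 0 <= t ->
  filterlim (fun r => scal (/ r) (minus (T r (orbit_int t x)) (orbit_int t x)))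
    (at_right 0) (locally (minus (T t x) x)).
Proof.
  intros Ht.
  pose (D := fun r => minus (orbit_int (t + r) x) (orbit_int r x)).
  assert (HD : is_derive D 0 (minus (T t x) x)).
  { unfold D. evar_last.
    - apply (is_derive_minus (V := V) (fun r => orbit_int (t + r) x)
        (fun r => orbit_int r x)).
      + apply (is_derive_comp (V := V) (fun r => orbit_int r x) (fun r => t + r)).
        * apply (is_derive_RInt_0 _ _ (C0_orbit_continuous x)).
        * auto_derive; [exact I | reflexivity].
      + apply (is_derive_RInt_0 _ _ (C0_orbit_continuous x)).
    - f_equal.
      + etransitivity; [apply (scal_one (V := V)) |].
        rewrite Rmax_right by lra. now rewrite Rplus_0_r.
      + rewrite Rmax_right by lra. apply (C0_zero T HT). }
  apply (proj2 (filterlim_norm_minus (V := V) (at_right 0) _ _)). intros eps Heps.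
  destruct (is_derive_norm D 0 _ HD (eps / 2) ltac:(lra)) as [d [Hd H]].
  exists (mkposreal d Hd). intros r Hr Hr0.
  assert (Hrd : Rabs r < d).
  { replace r with (r - 0) by ring. exact Hr. }
  specialize (H r Hrd). rewrite (Rabs_pos_eq r) in H by lra.
  assert (E : minus (T r (orbit_int t x)) (orbit_int t x)
    = minus (D (0 + r)) (D 0)).
  { rewrite Rplus_0_l. unfold D. rewrite Rplus_0_r.
    rewrite orbit_int_plus by lra.
    replace (orbit_int 0 x) with (@zero V).
    2: { symmetry. apply (RInt_point (V := V)). }
    f_equal.
    - rewrite plus_comm. symmetry. apply (minus_plus_l (V := V)).
    - symmetry. apply (minus_zero_r (G := V)). }
  rewrite E.
  assert (E2 : minus (scal (/ r) (minus (D (0 + r)) (D 0))) (minus (T t x) x) =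
    scal (/ r) (minus (minus (D (0 + r)) (D 0)) (scal r (minus (T t x) x)))).
  { etransitivity; [| symmetry; apply (scal_minus_distr_l (V := V))].
    apply (f_equal (minus _)). symmetry.
    etransitivity; [apply (scal_assoc (V := V)) |].
    etransitivity; [| apply (scal_one (V := V))].
    apply (f_equal (fun a : R => scal a (minus (T t x) x))).
    now apply Rinv_l, Rgt_not_eq. }
  eapply Rle_lt_trans; [right; exact (f_equal norm E2) |].
  eapply Rle_lt_trans; [apply (norm_scal_le (V := V)) |].
  rewrite Rabs_pos_eq by (left; apply Rinv_0_lt_compat; lra).
  eapply Rle_lt_trans; [apply Rmult_le_compat_l; [| exact H] |].
  - left; apply Rinv_0_lt_compat; lra.
  - replace (/ r * (eps / 2 * r)) with (eps / 2) by (field; lra). lra.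
Qed.

End Semigroup.

(** * Restriction of scalars and the extrapolation space *)

Lemma is_linear_realify {k : scalar_field}
  {V W : CompleteNormedModule (scalars k)} (l : V -> W) :
  is_linear l -> is_linear (U := realify V) (V := realify W) l.
Proof.
  intros Hl. split.
  - exact (linear_plus l Hl).
  - intros a x. exact (linear_scal l Hl (of_real k a) x).
  - exact (linear_norm l Hl).
Qed.

Lemma C0_realify {k : scalar_field} {V : CompleteNormedModule (scalars k)}
  (T : R -> V -> V) : C0_semigroup T -> C0_semigroup (V := realify V) T.
Proof.
  intros HT. split.
  - intros t Ht. apply is_linear_realify, (C0_linear T HT t Ht).
  - exact (C0_zero T HT).
  - exact (C0_plus T HT).
  - exact (C0_continuous T HT).
Qed.

(** [S t x] stands for the state reached at time [t] from rest under the
    constant input generated by [x].  The last property is the cocycle identity that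
    makes a trajectory restartable while its input is being held. *)
Record is_input_map {V : NormedModule R_AbsRing} (T S : R -> V -> V) : Prop := {
  input_linear : forall t, 0 <= t -> is_linear (S t);
  input_bounded : forall a, exists M, 0 <= M /\
    forall t x, 0 <= t <= a -> norm (S t x) <= M * norm x;
  input_plus : forall s t x, 0 <= s -> 0 <= t ->
    S (s + t) x = plus (T t (S s x)) (S t x)
}.

Section Extrapolation.
Context {k : scalar_field} {X X1 : CompleteNormedModule (scalars k)}.
Context (A : partial_operator X) (T : R -> X -> X) (HA : generates A T).
Context (lambda : scalars k) (Hlambda : resolvent_set A lambda).
Context (j : X -> X1) (Hj : is_extrapolation_space A lambda j).
Context (T1 : R -> X1 -> X1) (HT1 : extends_semigroup j T T1).

Notation XR := (realify X).
Notation X1R := (realify X1).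

Let HTR : C0_semigroup (V := XR) T := C0_realify T (proj1 HA).
Let HT1R : C0_semigroup (V := X1R) T1 := C0_realify T1 (proj1 HT1).

Lemma resolvent_eq (x : X) :
  dom A x -> resolvent A lambda (minus (scal lambda x) (A x)) = x.
Proof.
  intros Hx. destruct Hlambda as [Hex _].
  destruct (Hex (minus (scal lambda x) (A x))) as [y [_ Hy]].
  apply iota_unique.
  - intros z Hz. rewrite <- (Hy z Hz). apply Hy. now split.
  - now split.
Qed.

Lemma embedding_linear : is_linear (U := XR) (V := X1R) j.
Proof.
  split.
  - exact (extra_plus A lambda j Hj).
  - intros a x. exact (extra_scal A lambda j Hj (of_real k a) x).
  - destruct (linear_norm _ (proj2 Hlambda)) as [M [HM HMR]].
    exists M. split; [exact HM |]. intros x.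
    eapply Rle_trans; [right; apply (extra_norm A lambda j Hj) | apply HMR].
Qed.

Lemma embedding_minus (x y : X) : j (minus x y) = minus (j x) (j y).
Proof. exact (linear_minus (U := XR) (V := X1R) j x y embedding_linear). Qed.

(** The resolvent of [x] is the solution [y] of [lambda y - A y = x], and
    [A 0 = 0] because [A] is a generator. *)
Lemma resolvent_zero_inv (x : X) : resolvent A lambda x = zero -> x = zero.
Proof.
  intros Hx. destruct Hlambda as [Hex _].
  pose proof (iota_correct _ (Hex x)) as [_ H].
  fold (resolvent A lambda x) in H. rewrite Hx in H.
  assert (H0 : A zero = zero).
  { apply (proj2 HA zero zero). apply filterlim_ext_loc with (fun _ => zero).
    - exists (mkposreal 1 Rlt_0_1). intros t _ Ht.
      assert (HTl : is_linear (T t)) by (apply (C0_linear T (proj1 HA)); lra).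
      rewrite (linear_zero _ HTl).
      transitivity (real_scal (V := X) (/ t) zero).
      + unfold real_scal. symmetry. apply (scal_zero_r (V := X)).
      + f_equal. symmetry. apply (minus_eq_zero (G := X)).
    - apply filterlim_const. }
  rewrite H0 in H. rewrite <- H.
  etransitivity; [apply (minus_zero_r (G := X)) |]. apply (scal_zero_r (V := X)).
Qed.

Lemma embedding_injective (x y : X) : j x = j y -> x = y.
Proof.
  intros Hxy. apply (norm_minus_eq_0 (V := X)).
  etransitivity; [apply f_equal, resolvent_zero_inv | apply (norm_zero (V := X))].
  apply (norm_eq_zero (V := X)).
  etransitivity; [symmetry; apply (extra_norm A lambda j Hj) |].
  etransitivity; [apply (f_equal (norm (V := X1))), embedding_minus |].
  rewrite Hxy. apply (norm_minus_self (V := X1R)).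
Qed.

Lemma embedding_orbit_int (t : R) (x : X) :
  j (orbit_int (V := XR) T t x) = orbit_int (V := X1R) T1 t (j x).
Proof.
  unfold orbit_int.
  rewrite <- (RInt_linear (V := XR) (W := X1R) j _ _ _ embedding_linear).
  - apply (RInt_ext (V := X1R)). intros s _. symmetry. apply (proj2 HT1), Rmax_l.
  - apply (ex_RInt_orbit (V := XR) T HTR).
Qed.

(** With [y = int_0^t T(s) x ds], which lies in the domain of [A] with
    [A y = T t x - x], one has [y = R (lambda y - A y)] for the resolvent [R],
    and [|R z| = |j z|].  Hence [|y|] is controlled by quantities of the
    extrapolation space only. *)
Lemma norm_orbit_int_le_embedding (a : R) :
  exists C, 0 <= C /\ forall t x, 0 <= t <= a ->
    norm (orbit_int (V := XR) T t x) <= C * norm (j x).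
Proof.
  destruct (C0_bounded (V := X1R) T1 HT1R a) as [M [HM1 HM]].
  exists (abs lambda * (Rmax 0 a * M) + (M + 1)).
  pose proof (Rmax_l 0 a) as Ha0. pose proof (Rmax_r 0 a) as Ha1.
  pose proof (abs_ge_0 lambda) as Hl0.
  assert (0 <= abs lambda * (Rmax 0 a * M)).
  { apply Rmult_le_pos; [exact Hl0 |]. apply Rmult_le_pos; lra. }
  split; [lra |]. intros t x Ht.
  set (y := orbit_int (V := XR) T t x).
  assert (Hy : dom A y /\ A y = minus (T t x) x).
  { apply (proj2 HA). apply (orbit_int_generator (V := XR) T HTR). lra. }
  destruct Hy as [Hdom HAy].
  pose proof (resolvent_eq y Hdom) as Hres. rewrite HAy in Hres.
  assert (Ejy : j y = orbit_int (V := X1R) T1 t (j x)) by apply embedding_orbit_int.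
  assert (Hjy : norm (j y) <= Rmax 0 a * M * norm (j x)).
  { rewrite Ejy. eapply Rle_trans.
    - apply (norm_orbit_int_le (V := X1R) T1 HT1R a M HM t (j x) Ht).
    - rewrite <- Rmult_assoc. apply Rmult_le_compat_r; [apply norm_ge_0 |].
      apply Rmult_le_compat_r; lra. }
  assert (Hbnd : norm (minus (T1 t (j x)) (j x)) <= (M + 1) * norm (j x)).
  { eapply Rle_trans; [apply (norm_minus_le (V := X1)) |].
    specialize (HM t (j x) Ht). change (norm (T1 t (j x)) <= M * norm (j x)) in HM.
    lra. }
  rewrite <- Hres. change (norm (V := XR)) with (norm (V := X)).
  rewrite <- (extra_norm A lambda j Hj).
  assert (E : j (minus (scal lambda y) (minus (T t x) x)) =
     minus (scal lambda (j y)) (minus (T1 t (j x)) (j x))).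
  { etransitivity; [apply embedding_minus |].
    apply (f_equal2 (minus (G := X1))); [apply (extra_scal A lambda j Hj) |].
    etransitivity; [apply embedding_minus |].
    now rewrite (proj2 HT1) by lra. }
  rewrite E. eapply Rle_trans; [apply (norm_minus_le (V := X1)) |].
  eapply Rle_trans; [apply Rplus_le_compat |].
  - apply (norm_scal (V := X1) lambda (j y)).
  - exact Hbnd.
  - rewrite (Rmult_plus_distr_r (abs lambda * _)). apply Rplus_le_compat_r.
    rewrite Rmult_assoc. now apply Rmult_le_compat_l.
Qed.

(** Integrals of orbits of the extrapolated semigroup take values in [X], by
    density of [X] and the preceding bound. *)
Lemma extrapolated_orbit_int_in_range (a : R) :
  exists C, 0 <= C /\ forall t (b : X1), 0 <= t <= a ->
    exists y : X, j y = orbit_int (V := X1R) T1 t b /\ norm y <= C * norm b.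
Proof.
  destruct (norm_orbit_int_le_embedding a) as [C [HC HCb]].
  exists C. split; [exact HC |]. intros t b Ht.
  assert (Hd : forall n : nat, exists x : X, norm (minus b (j x)) < / (INR n + 1)).
  { intros n. assert (H : 0 < / (INR n + 1)).
    { apply Rinv_0_lt_compat. pose proof (pos_INR n). lra. }
    exact (extra_dense A lambda j Hj b (mkposreal _ H)). }
  pose (x := fun n => proj1_sig (constructive_indefinite_description _ (Hd n))).
  assert (Hx : forall n, norm (minus b (j (x n))) < / (INR n + 1)).
  { intros n. exact (proj2_sig (constructive_indefinite_description _ (Hd n))). }
  clearbody x. clear Hd.
  assert (Hsmall : forall eps, 0 < eps -> exists N, forall n, (N <= n)%nat ->
    norm (minus b (j (x n))) < eps).
  { intros eps Heps. destruct (INR_unbounded (/ eps)) as [N HN].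
    exists N. intros n Hn. eapply Rlt_trans; [apply Hx |].
    rewrite <- (Rinv_inv eps). apply le_INR in Hn.
    pose proof (Rinv_0_lt_compat eps Heps).
    apply Rinv_lt_contravar; [apply Rmult_lt_0_compat |]; lra. }
  pose (y := fun n => orbit_int (V := XR) T t (x n)).
  assert (HlinX : is_linear (U := XR) (V := XR) (orbit_int (V := XR) T t))
    by (apply orbit_int_linear; [exact HTR | lra]).
  assert (HlinX1 : is_linear (U := X1R) (V := X1R) (orbit_int (V := X1R) T1 t))
    by (apply orbit_int_linear; [exact HT1R | lra]).
  destruct (cauchy_seq_cvg (V := XR) y) as [l Hl].
  { intros eps Heps.
    destruct (Hsmall (eps / (2 * (C + 1)))) as [N HN].
    { apply Rdiv_lt_0_compat; lra. }
    exists N. intros n m Hn Hm.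
    eapply Rle_lt_trans.
    { right. apply (f_equal norm). symmetry. apply (linear_minus _ _ _ HlinX). }
    eapply Rle_lt_trans; [now apply HCb |].
    assert (Hj2 : norm (j (minus (x n) (x m))) <= eps / (C + 1)).
    { eapply Rle_trans.
      { right. apply (f_equal (norm (V := X1))), embedding_minus. }
      eapply Rle_trans; [apply (norm_minus_trans (V := X1) _ b) |].
      pose proof (HN n Hn) as H1. pose proof (HN m Hm) as H2.
      replace (eps / (C + 1)) with (eps / (2 * (C + 1)) + eps / (2 * (C + 1)))
        by (field; lra).
      apply Rplus_le_compat; [| left; exact H2].
      eapply Rle_trans; [right; apply (norm_minus_sym (V := X1)) | left; exact H1]. }
    apply Rle_lt_trans with (C * (eps / (C + 1))).
    - apply Rmult_le_compat_l; [exact HC | exact Hj2].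
    - apply Rlt_le_trans with ((C + 1) * (eps / (C + 1))).
      + apply Rmult_lt_compat_r; [apply Rdiv_lt_0_compat |]; lra.
      + right. field. lra. }
  exists l. split.
  - apply (filterlim_locally_unique (V := X1R) (F := eventually) (fun n => j (y n))).
    + eapply filterlim_comp; [exact Hl |].
      exact (linear_cont (U := XR) (V := X1R) j l embedding_linear).
    + apply filterlim_ext with (fun n => orbit_int (V := X1R) T1 t (j (x n))).
      { intros n. symmetry. apply embedding_orbit_int. }
      eapply filterlim_comp;
        [| exact (linear_cont (U := X1R) (V := X1R) _ b HlinX1)].
      apply (proj2 (filterlim_norm_minus (V := X1R) eventually _ _)). intros eps Heps.
      destruct (Hsmall eps Heps) as [N HN]. exists N. intros n Hn.
      eapply Rle_lt_trans; [right; apply (norm_minus_sym (V := X1R)) |].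
      now apply HN.
  - apply le_epsilon. intros eps Heps.
    assert (Hz : forall z : X, norm (minus z zero) = norm z).
    { intros z. apply (f_equal norm), (minus_zero_r (G := X)). }
    rewrite <- (Hz l).
    apply (norm_lim_le (V := XR) eventually y); [exact Hl |].
    destruct (Hsmall (eps / (C + 1))) as [N HN].
    { apply Rdiv_lt_0_compat; lra. }
    exists N. intros n Hn. eapply Rle_trans; [right; apply Hz |].
    eapply Rle_trans; [now apply HCb |].
    assert (Hjx : norm (j (x n)) <= norm b + eps / (C + 1)).
    { eapply Rle_trans; [apply (norm_le_minus (V := X1) _ b) |].
      specialize (HN n Hn).
      rewrite Rplus_comm. apply Rplus_le_compat_l.
      eapply Rle_trans; [right; apply (norm_minus_sym (V := X1)) | left; exact HN]. }
    apply Rle_trans with (C * (norm b + eps / (C + 1))).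
    + now apply Rmult_le_compat_l.
    + assert (C * (eps / (C + 1)) <= eps).
      { replace eps with ((C + 1) * (eps / (C + 1))) at 2 by (field; lra).
        apply Rmult_le_compat_r; [left; apply Rdiv_lt_0_compat |]; lra. }
      lra.
Qed.

Context {U : CompleteNormedModule (scalars k)}.
Context (B : U -> X1) (HB : is_linear B) (F : X -> U) (HF : is_linear F).

Lemma embedding_S_op (t : R) (u : U) : 0 <= t ->
  j (S_op j T1 B t u) = orbit_int (V := X1R) T1 t (B u).
Proof.
  intros Ht.
  assert (E : vec_RInt (fun s => T1 s (B u)) 0 t = orbit_int (V := X1R) T1 t (B u)).
  { apply (RInt_ext (V := X1R)). intros s. rewrite Rmin_left, Rmax_right by lra. intros Hs.
    rewrite Rmax_right by lra. reflexivity. }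
  destruct (extrapolated_orbit_int_in_range t) as [C [_ HC]].
  destruct (HC t (B u) ltac:(lra)) as [y [Hy _]]. unfold S_op. rewrite E.
  apply (iota_correct (V := X) (fun x => j x = orbit_int (V := X1R) T1 t (B u))).
  exists y. split; [exact Hy |]. intros z Hz. apply embedding_injective.
  now rewrite Hy, Hz.
Qed.

(** Linearity and the cocycle identity hold in the extrapolation space, where
    [SF_op] is an integrated orbit, and are pulled back along the injective
    embedding; boundedness is that of the lifted integral. *)
Lemma SF_op_input_map :
  is_input_map (V := XR) T (SF_op j T1 B F).
Proof.
  assert (HlinBF : is_linear (U := XR) (V := X1R) (fun x => B (F x))).
  { exact (is_linear_realify (V := X) (W := X1) _ (is_linear_comp F B HF HB)). }
  assert (Hbd : forall a, exists M, 0 <= M /\ forall t x, 0 <= t <= a ->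
    norm (V := XR) (SF_op j T1 B F t x) <= M * norm (V := XR) x).
  { intros a. destruct (extrapolated_orbit_int_in_range a) as [C [HC0 HC]].
    destruct (linear_norm _ HlinBF) as [M [HM HMB]].
    exists (C * M). split; [apply Rmult_le_pos; lra |]. intros t x Ht.
    destruct (HC t (B (F x)) Ht) as [y [Hy Hny]].
    assert (E : SF_op j T1 B F t x = y).
    { apply embedding_injective. unfold SF_op. rewrite embedding_S_op by lra.
      now rewrite Hy. }
    rewrite E. eapply Rle_trans; [exact Hny |].
    rewrite Rmult_assoc. apply Rmult_le_compat_l; [exact HC0 | apply HMB]. }
  split; [| exact Hbd |].
  - intros t Ht.
    pose proof (orbit_int_linear (V := X1R) T1 HT1R t Ht) as Hlin1.
    pose proof (is_linear_comp _ _ HlinBF Hlin1) as Hlin. split.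
    + intros x y. apply embedding_injective.
      etransitivity; [apply embedding_S_op, Ht |].
      etransitivity; [apply (linear_plus _ Hlin x y) |]. symmetry.
      etransitivity; [apply (linear_plus _ embedding_linear) |].
      unfold SF_op. rewrite !embedding_S_op by exact Ht. reflexivity.
    + intros a x. apply embedding_injective.
      etransitivity; [apply embedding_S_op, Ht |].
      etransitivity; [apply (linear_scal _ Hlin a x) |]. symmetry.
      etransitivity; [apply (linear_scal _ embedding_linear) |].
      unfold SF_op. rewrite !embedding_S_op by exact Ht. reflexivity.
    + destruct (Hbd t) as [M [HM HMb]]. exists (M + 1). split; [lra |].
      intros x. eapply Rle_trans; [apply HMb; lra |].
      apply Rmult_le_compat_r; [apply norm_ge_0 | lra].
  - intros s t x Hs Ht. apply embedding_injective. unfold SF_op.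
    rewrite embedding_S_op by lra.
    etransitivity; [apply (orbit_int_plus (V := X1R) T1 HT1R); lra |]. symmetry.
    etransitivity; [apply (linear_plus _ embedding_linear) |].
    rewrite <- (proj2 HT1) by exact Ht.
    rewrite !embedding_S_op by assumption. reflexivity.
Qed.

(** The variation-of-constants identity posed in the extrapolation space is an
    identity in [X]: the input enters through [S_op], the nonlinearity through
    a convolution with values in [X]. *)
Lemma held_input_formula_mild (phi : X -> X) (x : R -> X) (s t : R) :
  (forall r, continuous (U := XR) (fun r => phi (x (s + Rmax 0 r))) r) -> 0 <= t ->
  held_input_formula j T T1 B F phi x s t ->
  x (s + t) = plus (plus (T t (x s)) (SF_op j T1 B F t (x s)))
    (conv (V := XR) T (fun r => phi (x (s + Rmax 0 r))) t).
Proof.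
  intros Hphi Ht H. apply embedding_injective.
  etransitivity; [exact H |]. symmetry.
  etransitivity; [apply (linear_plus _ embedding_linear) |].
  etransitivity; [apply (f_equal (fun z : X1R => plus z _)),
                   (linear_plus _ embedding_linear) |].
  etransitivity; [symmetry; apply (plus_assoc (G := X1R)) |].
  apply (f_equal (plus (j (T t (x s))))).
  unfold SF_op. rewrite embedding_S_op by exact Ht.
  unfold orbit_int, conv.
  rewrite <- (RInt_reflect (V := X1R) (fun r => T1 (Rmax 0 r) (B (F (x s)))))
    by (apply C0_orbit_continuous, HT1R).
  rewrite <- (RInt_linear (V := XR) (W := X1R) j _ _ _ embedding_linear).
  2: { apply ex_RInt_cont, conv_integrand_continuous; [exact HTR | exact Hphi]. }
  etransitivity.
  - symmetry. apply (RInt_plus (V := X1R)).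
    + apply ex_RInt_cont.
      apply (conv_integrand_continuous (V := X1R) T1 HT1R (fun _ => B (F (x s)))).
      intros r. apply continuous_const.
    + apply ex_RInt_cont. intros r.
      apply (continuous_comp (V := XR) (fun r => T (Rmax 0 (t - r)) (phi (x (s + Rmax 0 r)))) j).
      * apply (conv_integrand_continuous (V := XR) T HTR
          (fun r => phi (x (s + Rmax 0 r)))), Hphi.
      * exact (linear_cont (U := XR) (V := X1R) j _ embedding_linear).
  - apply (RInt_ext (V := X1R)). intros r. rewrite Rmin_left, Rmax_right by lra. intros Hr.
    rewrite !Rmax_right by lra. rewrite <- (proj2 HT1) by lra.
    symmetry. apply (linear_plus _ (C0_linear T1 (proj1 HT1) (t - r) ltac:(lra))).
Qed.

End Extrapolation.

(** * Operator norms *)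

(** [real] turns an infinite supremum into [0], so a bound [M] is needed before
    the real supremum has its usual properties. *)
Lemma real_Lub_bounds (E : R -> Prop) (r0 M : R) :
  E r0 -> (forall r, E r -> r <= M) ->
  (forall r, E r -> r <= real (Lub_Rbar E)) /\
  (forall b, (forall r, E r -> r <= b) -> real (Lub_Rbar E) <= b).
Proof.
  intros H0 HM. destruct (Lub_Rbar_correct E) as [Hub Hlub].
  assert (Hfin : is_finite (Lub_Rbar E)).
  { specialize (Hub r0 H0). specialize (Hlub (Finite M) HM).
    destruct (Lub_Rbar E); [reflexivity | easy | easy]. }
  rewrite <- Hfin in Hub, Hlub. split.
  - exact Hub.
  - intros b Hb. exact (Hlub (Finite b) Hb).
Qed.

Lemma op_norm_bounds {V W : NormedModule R_AbsRing} (l : V -> W) (M : R) :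
  is_linear l -> 0 <= M -> (forall x, norm (l x) <= M * norm x) ->
  0 <= op_norm l <= M /\ forall x, norm (l x) <= op_norm l * norm x.
Proof.
  intros Hl HM HlM.
  destruct (real_Lub_bounds
    (fun r => exists x : V, norm x <= 1 /\ r = norm (l x)) (norm (l zero)) M)
    as [Hub Hlub].
  - exists zero. rewrite norm_zero. split; [lra | reflexivity].
  - intros r [x [Hx ->]]. specialize (HlM x). pose proof (norm_ge_0 x). nra.
  - fold (op_norm l) in Hub, Hlub. split; [split |].
    + eapply Rle_trans; [apply (norm_ge_0 (l zero)) |].
      apply Hub. exists zero. rewrite norm_zero. split; [lra | reflexivity].
    + apply Hlub. intros r [x [Hx ->]].
      specialize (HlM x). pose proof (norm_ge_0 x). nra.
    + intros x. destruct (Req_dec (norm x) 0) as [Hx | Hx].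
      { apply norm_eq_zero in Hx.
        rewrite Hx, (linear_zero _ Hl), !norm_zero. lra. }
      assert (Hx0 : 0 < norm x) by (pose proof (norm_ge_0 x); lra).
      assert (Hu : norm (l (scal (/ norm x) x)) <= op_norm l).
      { apply Hub. exists (scal (/ norm x) x). split; [| reflexivity].
        eapply Rle_trans; [apply norm_scal_le |].
        rewrite Rabs_pos_eq by (left; now apply Rinv_0_lt_compat).
        right. field. lra. }
      assert (E : l x = scal (norm x) (l (scal (/ norm x) x))).
      { rewrite <- (linear_scal _ Hl), scal_assoc.
        transitivity (l (scal one x)); [now rewrite scal_one |].
        apply (f_equal (fun a : R => l (scal a x))).
        symmetry. now apply Rinv_r. }
      rewrite E at 1. eapply Rle_trans; [apply norm_scal_le |].
      rewrite Rabs_pos_eq by lra. rewrite Rmult_comm.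
      apply Rmult_le_compat_r; lra.
Qed.

Lemma sup_op_norm_bounds {V W : NormedModule R_AbsRing} (G : R -> V -> W)
  (h M : R) :
  0 <= h -> 0 <= M -> (forall t, 0 <= t <= h -> is_linear (G t)) ->
  (forall t x, 0 <= t <= h -> norm (G t x) <= M * norm x) ->
  0 <= sup_op_norm G h /\
  forall t x, 0 <= t <= h -> norm (G t x) <= sup_op_norm G h * norm x.
Proof.
  intros Hh HM Hlin HGM.
  assert (Hop : forall t, 0 <= t <= h -> 0 <= op_norm (G t) <= M /\
    forall x, norm (G t x) <= op_norm (G t) * norm x).
  { intros t Ht. apply op_norm_bounds; auto. }
  destruct (real_Lub_bounds
    (fun r => exists t, 0 <= t <= h /\ r = op_norm (G t)) (op_norm (G 0)) M)
    as [Hub _].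
  - exists 0. split; [lra | reflexivity].
  - intros r [t [Ht ->]]. now apply Hop.
  - fold (sup_op_norm G h) in Hub. split.
    + apply Rle_trans with (op_norm (G 0)); [apply Hop; lra |].
      apply Hub. exists 0. split; [lra | reflexivity].
    + intros t x Ht. eapply Rle_trans; [now apply Hop |].
      apply Rmult_le_compat_r; [apply norm_ge_0 |]. apply Hub. now exists t.
Qed.

(** * A norm adapted to a power stable operator *)

Section AdaptedNorm.
Context {V : NormedModule R_AbsRing} (D : V -> V) (HD : is_linear D).
Context (Omega omega : R) (Homega : 0 < omega).
Context (Hpow : forall n x, norm (Nat.iter n D x) <= Omega * omega ^ n * norm x).

(** A power stable operator contracts in this norm by the factor [omega],
    without the constant [Omega] that the original norm would cost at every step. *)
Definition adapted_norm (x : V) : R :=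
  real (Lub_Rbar (fun r => exists n, r = norm (Nat.iter n D x) / omega ^ n)).

Lemma adapted_norm_bounds (x : V) :
  (forall n, norm (Nat.iter n D x) <= adapted_norm x * omega ^ n) /\
  (forall b, (forall n, norm (Nat.iter n D x) <= b * omega ^ n) ->
    adapted_norm x <= b).
Proof.
  assert (Hp : forall n, 0 < omega ^ n) by (intros n; now apply pow_lt).
  destruct (real_Lub_bounds
    (fun r => exists n, r = norm (Nat.iter n D x) / omega ^ n)
    (norm x / 1) (Omega * norm x)) as [Hub Hlub].
  - now exists 0%nat.
  - intros r [n ->]. apply Rle_div_l; [apply Hp |].
    eapply Rle_trans; [apply Hpow |]. right. ring.
  - split.
    + intros n. apply Rle_div_l; [apply Hp |]. apply Hub. now exists n.
    + intros b Hb. apply Hlub. intros r [n ->].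
      apply Rle_div_l; [apply Hp | apply Hb].
Qed.

Lemma norm_le_adapted (x : V) : norm x <= adapted_norm x.
Proof.
  destruct (adapted_norm_bounds x) as [H _]. specialize (H 0%nat).
  simpl in H. lra.
Qed.

Lemma adapted_norm_le (x : V) : adapted_norm x <= Omega * norm x.
Proof.
  apply adapted_norm_bounds. intros n.
  eapply Rle_trans; [apply Hpow |]. right. ring.
Qed.

Lemma adapted_norm_triangle (x y : V) :
  adapted_norm (plus x y) <= adapted_norm x + adapted_norm y.
Proof.
  apply adapted_norm_bounds. intros n.
  assert (E : Nat.iter n D (plus x y) = plus (Nat.iter n D x) (Nat.iter n D y)).
  { induction n as [| n IH]; [reflexivity |].
    simpl. rewrite IH. apply (linear_plus _ HD). }
  rewrite E. eapply Rle_trans; [apply norm_triangle |].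
  pose proof (proj1 (adapted_norm_bounds x) n).
  pose proof (proj1 (adapted_norm_bounds y) n). lra.
Qed.

Lemma adapted_norm_contraction (x : V) :
  adapted_norm (D x) <= omega * adapted_norm x.
Proof.
  apply adapted_norm_bounds. intros n.
  rewrite <- Nat.iter_succ_r.
  eapply Rle_trans; [apply (proj1 (adapted_norm_bounds x)) |].
  right. simpl. ring.
Qed.

End AdaptedNorm.

(** * Mild trajectories under a held input *)

Section MildTrajectories.
Context {V : CompleteNormedModule R_AbsRing} (T S : R -> V -> V).
Context (HT : C0_semigroup T) (HS : is_input_map T S).
Context (phi : V -> V) (L : R) (HL : 0 <= L) (Hphi0 : phi zero = zero).
Context (Hphi : forall x y, norm (minus (phi x) (phi y)) <= L * norm (minus x y)).

(** The state [x0] at time [0] and the vector [xi] that generates the input are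
    kept apart, because a trajectory restarted between two updates keeps its
    old input. *)
Definition mild_trajectory (x0 xi : V) (y : R -> V) (a : R) : Prop :=
  (forall r, continuous y r) /\
  forall t, 0 <= t <= a ->
    y t = plus (plus (T t x0) (S t xi)) (conv T (fun r => phi (y r)) t).

Lemma lipschitz_continuous_comp (y : R -> V) (r : R) :
  continuous y r -> continuous (fun s => phi (y s)) r.
Proof.
  intros Hy. apply (continuous_norm (V := V) (fun s => phi (y s)) r).
  intros eps Heps.
  destruct (proj1 (continuous_norm y r) Hy (eps / (L + 1))) as [d [Hd H]].
  { apply Rdiv_lt_0_compat; lra. }
  exists d. split; [exact Hd |]. intros s Hs.
  eapply Rle_lt_trans; [apply Hphi |].
  apply Rle_lt_trans with (L * (eps / (L + 1))).
  - apply Rmult_le_compat_l; [exact HL |]. left. exact (H s Hs).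
  - apply Rlt_le_trans with ((L + 1) * (eps / (L + 1))).
    + apply Rmult_lt_compat_r; [apply Rdiv_lt_0_compat |]; lra.
    + right. field. lra.
Qed.

Lemma norm_lipschitz_le (x : V) : norm (phi x) <= L * norm x.
Proof.
  pose proof (Hphi x zero) as H. rewrite Hphi0 in H.
  assert (Hz : forall z : V, norm (minus z zero) = norm z).
  { intros z. apply f_equal, (minus_zero_r (G := V)). }
  eapply Rle_trans; [right; symmetry; apply Hz |].
  eapply Rle_trans; [exact H |]. right. apply f_equal, Hz.
Qed.

Lemma continuous_norm_comp (y : R -> V) (r : R) :
  continuous y r -> continuous (fun s => norm (y s)) r.
Proof.
  intros Hy. apply (continuous_comp y norm); [exact Hy |].
  apply (filterlim_norm (y r)).
Qed.

Lemma mild_formula_at_0 (x0 xi : V) (f : R -> V) :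
  plus (plus (T 0 x0) (S 0 xi)) (conv T f 0) = x0.
Proof.
  rewrite (C0_zero T HT).
  assert (HS0 : S 0 xi = zero).
  { apply (plus_reg_l (G := V) (S 0 xi)).
    etransitivity; [| symmetry; apply (plus_zero_r (G := V))].
    pose proof (input_plus T S HS 0 0 xi (Rle_refl 0) (Rle_refl 0)) as H.
    rewrite (C0_zero T HT), Rplus_0_r in H. now symmetry. }
  rewrite HS0. unfold conv. rewrite (RInt_point (V := V)).
  etransitivity; [apply (plus_zero_r (G := V)) | apply (plus_zero_r (G := V))].
Qed.

(** The semigroup law, the cocycle identity and the splitting of convolutions
    combine to restart the trajectory at time [s]. *)
Lemma mild_restart (x0 xi : V) (y : R -> V) (a s b : R) :
  mild_trajectory x0 xi y a -> 0 <= s -> s + b <= a ->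
  mild_trajectory (y s) xi (fun r => y (s + r)) b.
Proof.
  intros [Hc Hy] Hs Hb. split.
  - intros r. apply (continuous_comp (fun r => s + r) y); [| apply Hc].
    apply (continuous_plus (V := R_NormedModule) (fun _ => s) (fun r => r)).
    + apply continuous_const.
    + apply continuous_id.
  - intros t Ht. rewrite (Hy (s + t)) by lra. rewrite (Hy s) at 1 by lra.
    assert (HTl : is_linear (T t)) by (apply (C0_linear T HT); lra).
    rewrite (conv_split T HT (fun r => phi (y r)));
      [| intros r; now apply lipschitz_continuous_comp | lra | lra].
    rewrite (Rplus_comm s t), (C0_plus T HT) by lra.
    rewrite (Rplus_comm t s), (input_plus T S HS) by lra.
    etransitivity; [| symmetry; apply (f_equal (fun z => plus (plus z _) _)),
      (linear_plus _ HTl)].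
    etransitivity; [| symmetry; apply (f_equal (fun z => plus (plus (plus z _) _) _)),
      (linear_plus _ HTl)].
    set (p := T t (T s x0)). set (q := T t (S s xi)). set (u := S t xi).
    set (c := T t _). set (d := conv T _ t).
    rewrite !plus_assoc. apply (f_equal (fun z => plus z d)).
    rewrite <- !plus_assoc. do 2 apply f_equal. apply plus_comm.
Qed.

(** The difference of two trajectories satisfies Gronwall's inequality with
    initial constant [0].  The triggering rule tests the trajectory that keeps
    the input after the update; by uniqueness it agrees with the solution up to
    the update. *)
Lemma mild_unique (x0 xi : V) (y z : R -> V) (a : R) :
  mild_trajectory x0 xi y a -> mild_trajectory x0 xi z a ->
  forall t, 0 <= t <= a -> y t = z t.
Proof.
  intros [Hyc Hy] [Hzc Hz] t Ht.
  destruct (C0_bounded T HT a) as [M [HM1 HM]].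
  pose (g := fun r => norm (minus (y r) (z r))).
  assert (Hg : forall r, continuous g r).
  { intros r. apply continuous_norm_comp. now apply (continuous_minus (V := V)). }
  assert (Hle : forall s, 0 <= s <= a -> g s <= 0 + M * L * RInt g 0 s).
  { intros s Hs. unfold g at 1. rewrite (Hy s Hs), (Hz s Hs).
    assert (E : forall u v w : V, minus (plus u v) (plus u w) = minus v w).
    { intros u v w. etransitivity; [apply (minus_plus_plus (V := V)) |].
      etransitivity; [| apply (plus_zero_l (G := V))].
      apply (f_equal (fun z => plus z _)), (minus_eq_zero (G := V)). }
    rewrite E, (conv_minus T HT) by (intros r; now apply lipschitz_continuous_comp).
    rewrite Rplus_0_l, Rmult_assoc.
    assert (Es : L * RInt g 0 s = RInt (fun r => L * g r) 0 s).
    { symmetry. apply (RInt_scal (V := R_CompleteNormedModule)).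
      now apply (ex_RInt_cont (V := R_CompleteNormedModule)). }
    rewrite Es. apply (norm_conv_le T HT _ _ M a); try assumption; try lra.
    - intros r. apply (continuous_minus (V := V));
        now apply lipschitz_continuous_comp.
    - intros r. apply (continuous_scal_r (V := R_NormedModule) L), Hg.
    - intros r _. apply Hphi. }
  assert (HK : 0 <= M * L) by (apply Rmult_le_pos; lra).
  pose proof (gronwall g 0 (M * L) a Hg HK Hle t Ht) as H.
  specialize (Hle t Ht). apply (norm_minus_eq_0 (V := V)).
  apply Rle_antisym; [| apply norm_ge_0].
  change (g t <= 0). lra.
Qed.

Context (h : R) (Hh : 0 < h) (c1 c2 c3 : R).
Context (Hc1 : 0 <= c1) (Hc2 : 0 <= c2) (Hc3 : 0 <= c3).
Context (HD1 : forall t x, 0 <= t <= h ->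
  norm (plus (T t x) (S t x)) <= c1 * norm x).
Context (HT2 : forall t x, 0 <= t <= h -> norm (T t x) <= c2 * norm x).
Context (HS3 : forall t x, 0 <= t <= h -> norm (S t x) <= c3 * norm x).

Lemma held_input_shift (t : R) (x0 xi : V) : 0 <= t ->
  plus (T t x0) (S t xi) =
  plus (plus (T t x0) (S t x0)) (S t (minus xi x0)).
Proof.
  intros Ht. rewrite <- plus_assoc. apply f_equal. symmetry.
  etransitivity; [apply (f_equal (plus _)),
    (linear_minus _ xi x0 (input_linear T S HS t Ht)) |].
  apply (plus_minus_l (V := V)).
Qed.

(** Over one sampling period the trajectory is the linear flow [T t + S t] of
    the initial state, perturbed by the mismatch [xi - x0] between the state and
    the held sample and by the nonlinearity; the nonlinearity is absorbed by
    Gronwall's inequality. *)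
Lemma norm_mild_le (x0 xi : V) (y : R -> V) :
  mild_trajectory x0 xi y h ->
  forall t, 0 <= t <= h ->
    let C := c1 * norm x0 + c3 * norm (minus xi x0) in
    norm (y t) <= C * exp (c2 * L * h) /\
    norm (conv T (fun r => phi (y r)) t) <= C * (exp (c2 * L * h) - 1).
Proof.
  intros [Hyc Hy] t Ht C.
  assert (HC : 0 <= C).
  { unfold C. apply Rplus_le_le_0_compat; apply Rmult_le_pos;
      auto using norm_ge_0. }
  pose (g := fun r => norm (y r)).
  assert (Hg : forall r, continuous g r).
  { intros r. now apply continuous_norm_comp. }
  assert (Hconv : forall s, 0 <= s <= h ->
    norm (conv T (fun r => phi (y r)) s) <= c2 * L * RInt g 0 s).
  { intros s Hs. rewrite Rmult_assoc.
    assert (Es : L * RInt g 0 s = RInt (fun r => L * g r) 0 s).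
    { symmetry. apply (RInt_scal (V := R_CompleteNormedModule)).
      now apply (ex_RInt_cont (V := R_CompleteNormedModule)). }
    rewrite Es. apply (norm_conv_le T HT _ _ c2 h); try assumption.
    - intros r. now apply lipschitz_continuous_comp.
    - intros r. apply (continuous_scal_r (V := R_NormedModule) L), Hg.
    - intros r _. apply norm_lipschitz_le. }
  assert (Hle : forall s, 0 <= s <= h -> g s <= C + c2 * L * RInt g 0 s).
  { intros s Hs. unfold g at 1. rewrite (Hy s Hs).
    eapply Rle_trans; [apply (norm_triangle (V := V)) |].
    apply Rplus_le_compat; [| now apply Hconv].
    rewrite held_input_shift by lra.
    eapply Rle_trans; [apply (norm_triangle (V := V)) |].
    apply Rplus_le_compat; [now apply HD1 | now apply HS3]. }
  assert (HK : 0 <= c2 * L) by now apply Rmult_le_pos.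
  pose proof (gronwall g C (c2 * L) h Hg HK Hle t Ht) as HG.
  assert (Hexp : C * exp (c2 * L * t) <= C * exp (c2 * L * h)).
  { apply Rmult_le_compat_l; [exact HC |].
    assert (Hm : c2 * L * t <= c2 * L * h) by (apply Rmult_le_compat_l; lra).
    destruct Hm as [Hm | Hm]; [left; now apply exp_increasing | rewrite Hm; lra]. }
  split.
  - eapply Rle_trans; [now apply Hle |]. lra.
  - eapply Rle_trans; [now apply Hconv |]. lra.
Qed.

Context (s eps omega Omega : R) (Heps : 0 <= eps).
Context (Homega : 0 < omega) (HOmega : 1 <= Omega) (Hs : 0 <= s).
Context (HSh : forall x, norm (S h x) <= s * norm x).
Context (N : V -> R).
Context (HN_ge : forall x, norm x <= N x).
Context (HN_le : forall x, N x <= Omega * norm x).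
Context (HN_plus : forall x y, N (plus x y) <= N x + N y).
Context (HN_D : forall x, N (plus (T h x) (S h x)) <= omega * N x).

Let E := exp (c2 * L * h) - 1.
Let rho := omega + c1 * Omega * E + eps * Omega * (s + c3 * E).

Context (Hrho : rho < 1).

Lemma growth_ge_0 : 0 <= E.
Proof.
  unfold E. pose proof (exp_ineq1_le (c2 * L * h)).
  assert (0 <= c2 * L * h) by (apply Rmult_le_pos; [apply Rmult_le_pos |]; lra).
  lra.
Qed.

Lemma adapted_norm_step (x0 xi : V) (y : R -> V) :
  mild_trajectory x0 xi y h -> norm (minus xi x0) <= eps * norm xi ->
  N (y h) <= (omega + c1 * Omega * E) * N x0 + eps * Omega * (s + c3 * E) * N xi.
Proof.
  intros Hy He.
  destruct (norm_mild_le x0 xi y Hy h ltac:(lra)) as [_ Hconv]. fold E in Hconv.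
  rewrite (proj2 Hy h) by lra. rewrite held_input_shift by lra.
  rewrite <- plus_assoc.
  eapply Rle_trans; [apply HN_plus |].
  pose proof growth_ge_0 as HE.
  pose proof (norm_ge_0 x0) as Hn0. pose proof (norm_ge_0 xi) as Hn1.
  set (w := plus (S h (minus xi x0)) _).
  assert (Hw : norm w <= (s + c3 * E) * (eps * N xi) + c1 * E * N x0).
  { eapply Rle_trans; [apply (norm_triangle (V := V)) |].
    assert (He2 : norm (minus xi x0) <= eps * N xi).
    { eapply Rle_trans; [exact He |]. now apply Rmult_le_compat_l. }
    assert (H1 : norm (S h (minus xi x0)) <= s * (eps * N xi)).
    { eapply Rle_trans; [apply HSh |]. now apply Rmult_le_compat_l. }
    assert (H2 : (c1 * norm x0 + c3 * norm (minus xi x0)) * E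
      <= (c1 * N x0 + c3 * (eps * N xi)) * E).
    { apply Rmult_le_compat_r; [exact HE |].
      apply Rplus_le_compat; now apply Rmult_le_compat_l. }
    eapply Rle_trans; [apply Rplus_le_compat; [exact H1 |] |].
    - eapply Rle_trans; [exact Hconv | exact H2].
    - right. ring. }
  assert (HNw : N w <= Omega * ((s + c3 * E) * (eps * N xi) + c1 * E * N x0)).
  { eapply Rle_trans; [apply HN_le |]. apply Rmult_le_compat_l; lra. }
  pose proof (HN_D x0). lra.
Qed.

(** Between two updates the adapted norm at the sampling times never exceeds its
    value [N xi] at the last update, so each one-step estimate gives the factor
    [rho] with respect to [N xi], however many steps have been made. *)
Lemma held_interval_decay (xi : V) (y : R -> V) (p : nat) :
  mild_trajectory xi xi y (INR p * h) ->
  (forall q, (q < p)%nat -> norm (minus xi (y (INR q * h))) <= eps * norm xi) ->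
  y 0 = xi ->
  forall q, (q <= p)%nat ->
    N (y (INR q * h)) <= N xi /\ ((1 <= q)%nat -> N (y (INR q * h)) <= rho * N xi).
Proof.
  intros Hy He H0. induction q as [| q IH]; intros Hq.
  { rewrite Rmult_0_l, H0. split; [lra | lia]. }
  destruct (IH ltac:(lia)) as [IH1 _].
  assert (HNxi : 0 <= N xi).
  { eapply Rle_trans; [apply (norm_ge_0 xi) | apply HN_ge]. }
  assert (Hstep : N (y (INR (Datatypes.S q) * h)) <= rho * N xi).
  { assert (Hq0 : 0 <= INR q * h) by (apply Rmult_le_pos; [apply pos_INR | lra]).
    assert (Hqp : INR q * h + h <= INR p * h).
    { apply le_INR in Hq. rewrite S_INR in Hq.
      replace (INR q * h + h) with ((INR q + 1) * h) by ring.
      apply Rmult_le_compat_r; lra. }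
    rewrite S_INR, Rmult_plus_distr_r, Rmult_1_l.
    pose proof (adapted_norm_step _ _ _ (mild_restart _ _ _ _ _ h Hy Hq0 Hqp)
      (He q ltac:(lia))) as H. simpl in H.
    eapply Rle_trans; [exact H |]. unfold rho.
    rewrite (Rmult_plus_distr_r (omega + _)). apply Rplus_le_compat_r.
    apply Rmult_le_compat_l; [| exact IH1].
    pose proof growth_ge_0.
    apply Rplus_le_le_0_compat; [lra |].
    apply Rmult_le_pos; [apply Rmult_le_pos |]; lra. }
  split; [| now intros _].
  assert (rho * N xi <= 1 * N xi) by (apply Rmult_le_compat_r; lra). lra.
Qed.

Lemma sampling_period_of (p : nat) (t : R) : (1 <= p)%nat ->
  0 <= t <= INR p * h ->
  exists q, (q < p)%nat /\ INR q * h <= t <= INR q * h + h.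
Proof.
  induction p as [| p IH]; [lia |]. intros _ Ht.
  destruct (Rle_dec (INR p * h) t) as [Hp | Hp].
  - exists p. rewrite S_INR in Ht. split; [lia | lra].
  - assert (p <> 0)%nat.
    { intros ->. simpl in Hp. lra. }
    destruct (IH ltac:(lia) ltac:(lra)) as [q [Hq Hqt]].
    exists q. split; [lia | exact Hqt].
Qed.

Lemma held_interval_bound (xi : V) (y : R -> V) (p : nat) :
  mild_trajectory xi xi y (INR p * h) -> (1 <= p)%nat ->
  (forall q, (q < p)%nat -> norm (minus xi (y (INR q * h))) <= eps * norm xi) ->
  y 0 = xi ->
  forall t, 0 <= t <= INR p * h ->
    norm (y t) <= (c1 + c3 * eps) * exp (c2 * L * h) * N xi.
Proof.
  intros Hy Hp He H0 t Ht.
  destruct (sampling_period_of p t Hp Ht) as [q [Hq Hqt]].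
  destruct (held_interval_decay xi y p Hy He H0 q ltac:(lia)) as [HNq _].
  assert (Hq0 : 0 <= INR q * h) by (apply Rmult_le_pos; [apply pos_INR | lra]).
  assert (Hqp : INR q * h + h <= INR p * h).
  { assert (Hq' := Hq). apply le_INR in Hq'. rewrite S_INR in Hq'.
    replace (INR q * h + h) with ((INR q + 1) * h) by ring.
    apply Rmult_le_compat_r; lra. }
  destruct (norm_mild_le _ _ _ (mild_restart _ _ _ _ _ h Hy Hq0 Hqp)
    (t - INR q * h) ltac:(lra)) as [H _].
  replace (INR q * h + (t - INR q * h)) with t in H by ring.
  eapply Rle_trans; [exact H |].
  replace ((c1 + c3 * eps) * exp (c2 * L * h) * N xi) with
    ((c1 * N xi + c3 * (eps * N xi)) * exp (c2 * L * h)) by ring.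
  apply Rmult_le_compat_r; [left; apply exp_pos |]. apply Rplus_le_compat.
  - apply Rmult_le_compat_l; [exact Hc1 |].
    eapply Rle_trans; [apply HN_ge | exact HNq].
  - apply Rmult_le_compat_l; [exact Hc3 |].
    eapply Rle_trans; [now apply He |]. now apply Rmult_le_compat_l.
Qed.

(** With [rho = exp (- gamma lmax h)], the factor [rho] gained at each update
    is at most [exp (- gamma (t (n + 1) - t n))], since updates are at most
    [lmax h] apart. *)
Lemma sampled_loop_decay (lmax : nat) : (1 <= lmax)%nat ->
  exists Gamma gamma, 1 <= Gamma /\ 0 < gamma /\
  forall (x : R -> V) (t : nat -> R),
    t 0%nat = 0 ->
    (forall n, exists p, (1 <= p <= lmax)%nat /\
       t (Datatypes.S n) = t n + INR p * h /\
       mild_trajectory (x (t n)) (x (t n)) (fun r => x (t n + Rmax 0 r)) (INR p * h) /\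
       forall q, (q < p)%nat ->
         norm (minus (x (t n)) (x (t n + INR q * h))) <= eps * norm (x (t n))) ->
    forall tau, 0 <= tau ->
      norm (x tau) <= Gamma * exp (- gamma * tau) * norm (x 0).
Proof.
  intros Hlmax.
  assert (HE := growth_ge_0).
  assert (Hrho0 : 0 < rho).
  { unfold rho. assert (0 <= c1 * Omega * E)
      by (apply Rmult_le_pos; [apply Rmult_le_pos |]; lra).
    assert (0 <= c3 * E) by (apply Rmult_le_pos; lra).
    assert (0 <= eps * Omega * (s + c3 * E))
      by (apply Rmult_le_pos; [apply Rmult_le_pos |]; lra). lra. }
  assert (Hlm : 1 <= INR lmax) by (apply (le_INR 1) in Hlmax; exact Hlmax).
  assert (Hlh : 0 < INR lmax * h) by (apply Rmult_lt_0_compat; lra).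
  set (gamma := - ln rho / (INR lmax * h)).
  assert (Hln : ln rho < 0) by (rewrite <- ln_1; now apply ln_increasing).
  assert (Hgamma : 0 < gamma) by (apply Rdiv_lt_0_compat; lra).
  assert (Hexp : exp (- gamma * (INR lmax * h)) = rho).
  { rewrite <- (exp_ln rho) by exact Hrho0. f_equal. unfold gamma. field.
    split; lra. }
  set (K := (c1 + c3 * eps) * exp (c2 * L * h)).
  assert (HK : 0 <= K).
  { apply Rmult_le_pos; [| left; apply exp_pos].
    apply Rplus_le_le_0_compat; [| apply Rmult_le_pos]; lra. }
  exists (Rmax 1 (K * Omega / rho)), gamma.
  split; [apply Rmax_l |]. split; [exact Hgamma |].
  intros x t Ht0 Hstep tau Htau.
  assert (Hexp_mono : forall a b, a <= b -> exp (- gamma * b) <= exp (- gamma * a)).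
  { intros a b [Hab | ->]; [left; apply exp_increasing; nra | lra]. }
  assert (Hupd : forall n, N (x (t n)) <= exp (- gamma * t n) * N (x 0)).
  { induction n as [| n IH].
    - rewrite Ht0, Rmult_0_r, exp_0. lra.
    - destruct (Hstep n) as [p [Hp [Etn [Hy He]]]].
      assert (Hyq : forall q, x (t n + Rmax 0 (INR q * h)) = x (t n + INR q * h)).
      { intros q. rewrite Rmax_right; [reflexivity |].
        apply Rmult_le_pos; [apply pos_INR | lra]. }
      destruct (held_interval_decay _ _ p Hy) with (q := p) as [_ H]; [| | lia |].
      + intros q Hq. rewrite Hyq. now apply He.
      + rewrite Rmax_left, Rplus_0_r by lra. reflexivity.
      + specialize (H ltac:(lia)). simpl in H. rewrite Hyq, <- Etn in H.
        eapply Rle_trans; [exact H |]. rewrite Etn.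
        rewrite Rmult_plus_distr_l, exp_plus.
        assert (Hrp : rho <= exp (- gamma * (INR p * h))).
        { rewrite <- Hexp. apply Hexp_mono. apply Rmult_le_compat_r; [lra |].
          apply le_INR. lia. }
        assert (0 <= N (x (t n))).
        { eapply Rle_trans; [apply (norm_ge_0 (x (t n))) | apply HN_ge]. }
        apply Rle_trans with (exp (- gamma * (INR p * h)) * N (x (t n))).
        * now apply Rmult_le_compat_r.
        * rewrite (Rmult_comm (exp (- gamma * t n))), Rmult_assoc.
          apply Rmult_le_compat_l; [left; apply exp_pos | exact IH]. }
  assert (Hlow : forall n, INR n * h <= t n).
  { induction n as [| n IH].
    - rewrite Ht0. simpl. lra.
    - destruct (Hstep n) as [p [Hp [Etn _]]]. rewrite Etn, S_INR.
      assert (1 <= INR p) by (apply (le_INR 1); lia). nra. }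
  assert (Hfind : exists n, t n <= tau <= t (Datatypes.S n)).
  { destruct (INR_unbounded (tau / h)) as [m Hm].
    assert (Htm : tau < t m).
    { eapply Rlt_le_trans; [| apply Hlow].
      apply Rmult_lt_compat_r with (r := h) in Hm; [| exact Hh].
      replace (tau / h * h) with tau in Hm by (field; lra). exact Hm. }
    clear Hm. induction m as [| m IH]; [lra |].
    destruct (Rle_dec (t m) tau) as [H | H]; [exists m; lra | apply IH; lra]. }
  destruct Hfind as [n Hn].
  destruct (Hstep n) as [p [Hp [Etn [Hy He]]]].
  assert (Hb : norm (x tau) <= K * N (x (t n))).
  { pose proof (held_interval_bound _ _ p Hy ltac:(lia)) as H.
    cbv beta in H.
    specialize (H ltac:(intros q Hq; rewrite Rmax_right;
      [now apply He | apply Rmult_le_pos; [apply pos_INR | lra]])).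
    specialize (H ltac:(rewrite Rmax_left, Rplus_0_r by lra; reflexivity)).
    specialize (H (tau - t n) ltac:(lra)). simpl in H.
    rewrite Rmax_right in H by lra.
    replace (t n + (tau - t n)) with tau in H by ring. exact H. }
  assert (Hlast : exp (- gamma * t n) <= exp (- gamma * tau) / rho).
  { apply Rle_div_r; [exact Hrho0 |]. rewrite <- Hexp, <- exp_plus.
    rewrite <- Rmult_plus_distr_l. apply Hexp_mono.
    assert (INR p * h <= INR lmax * h).
    { apply Rmult_le_compat_r; [lra |]. apply le_INR. lia. }
    lra. }
  pose proof (norm_ge_0 (x 0)) as Hx0.
  eapply Rle_trans; [exact Hb |].
  apply Rle_trans with (K * (exp (- gamma * tau) / rho * (Omega * norm (x 0)))).
  - apply Rmult_le_compat_l; [exact HK |].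
    eapply Rle_trans; [apply Hupd |].
    apply Rmult_le_compat; [left; apply exp_pos | | exact Hlast | apply HN_le].
    eapply Rle_trans; [apply (norm_ge_0 (x 0)) | apply HN_ge].
  - replace (K * (exp (- gamma * tau) / rho * (Omega * norm (x 0)))) with
      (K * Omega / rho * exp (- gamma * tau) * norm (x 0)) by (field; lra).
    apply Rmult_le_compat_r; [exact Hx0 |].
    apply Rmult_le_compat_r; [left; apply exp_pos | apply Rmax_r].
Qed.

End MildTrajectories.

(** * The event-triggered closed loop *)

Section EventTriggering.
Context {k : scalar_field} {X U X1 : CompleteNormedModule (scalars k)}.
Context (j : X -> X1) (T : R -> X -> X) (T1 : R -> X1 -> X1).
Context (B : U -> X1) (F : X -> U) (phi : X -> X).
Context (h eps : R) (lmax : nat) (Hh : 0 < h) (Hlmax : (1 <= lmax)%nat).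

(** Both [tk + lmax h] and the triggering time are multiples of [h], so updates
    stay on the sampling grid, and no earlier sampling time satisfies the
    triggering condition. *)
Lemma next_update_sampled (m : nat) (xi : X) (t' : R) :
  next_update j T T1 B F phi h eps lmax (INR m * h) xi t' ->
  exists (p : nat) (z : R -> X), (1 <= p <= lmax)%nat /\
    t' = INR m * h + INR p * h /\
    held_trajectory j T T1 B F phi (INR m * h) xi z /\
    forall q, (1 <= q < p)%nat ->
      norm (minus (z (INR m * h + INR q * h)) xi) <= eps * norm xi.
Proof.
  intros [z [tbar [Hz [Hmin Ht']]]].
  (* The hypothesis says that no triggering sample precedes [t_k + p h]. *)
  assert (Hquiet : forall (p q : nat), (1 <= q < p)%nat ->
    (forall s, (exists l : nat, (1 <= l)%nat /\ s = INR l * h /\ INR m * h < s /\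
       norm (minus (z s) xi) > eps * norm xi) -> INR m * h + INR p * h <= s) ->
    norm (minus (z (INR m * h + INR q * h)) xi) <= eps * norm xi).
  { intros p q Hq Hp. apply Rnot_lt_le. intros Hlt.
    assert (Hqp : INR q < INR p) by (apply lt_INR; lia).
    assert (Hq0 : 0 < INR q) by (apply (lt_INR 0); lia).
    assert (INR q * h < INR p * h) by now apply Rmult_lt_compat_r.
    assert (0 < INR q * h) by now apply Rmult_lt_0_compat.
    assert (Hpq : INR m * h + INR p * h <= INR m * h + INR q * h).
    { apply Hp. exists (m + q)%nat. rewrite plus_INR.
      repeat split; [lia | ring | lra | exact Hlt]. }
    lra. }
  destruct tbar as [r | |]; simpl in Hmin, Ht'.
  - destruct Hmin as [[l [Hl [Hr [Hmr _]]]] Hlow].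
    injection Ht' as Ht'. unfold Rmin in Ht'.
    destruct (Rle_dec (INR m * h + INR lmax * h) r) as [Hle | Hle].
    + exists lmax, z. repeat split; try lia; try assumption; try apply Hz.
      intros q Hq. apply (Hquiet lmax q Hq). intros s Hs.
      specialize (Hlow s Hs). lra.
    + assert (Hml : INR m < INR l) by (apply Rmult_lt_reg_r with h; lra).
      apply INR_lt in Hml.
      assert (El : INR l = INR m + INR (l - m)).
      { rewrite <- plus_INR. f_equal. lia. }
      assert (Hll : INR (l - m) < INR lmax).
      { apply Rmult_lt_reg_r with h; [exact Hh |]. rewrite El in Hr. lra. }
      apply INR_lt in Hll.
      assert (Er : r = INR m * h + INR (l - m) * h) by (rewrite Hr, El; ring).
      exists (l - m)%nat, z. repeat split; try lia; try apply Hz.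
      * now rewrite Ht'.
      * intros q Hq. apply (Hquiet _ q Hq). intros s Hs.
        rewrite <- Er. now apply Hlow.
  - injection Ht' as Ht'. exists lmax, z.
    repeat split; try lia; try assumption; try apply Hz.
    intros q Hq. apply (Hquiet lmax q Hq). intros s Hs. destruct (Hmin s Hs).
  - destruct Hmin.
Qed.

End EventTriggering.

Theorem lemma4p5
  (k : scalar_field) (X U : HilbertSpace k)
  (A : partial_operator X) (T : R -> X -> X) (hA : generates A T)
  (lambda : scalars k) (hlambda : resolvent_set A lambda)
  (X1 : CompleteNormedModule (scalars k)) (j : X -> X1)
  (hX1 : is_extrapolation_space A lambda j)
  (T1 : R -> X1 -> X1) (hT1 : extends_semigroup j T T1)
  (B : U -> X1) (hB : is_linear B)
  (F : X -> U) (hF : compact_operator F)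
  (phi : X -> X) (L : R) (hL : 0 <= L) (hphi0 : phi zero = zero)
  (hphi : forall xi1 xi2 : X,
     norm (minus (phi xi1) (phi xi2)) <= L * norm (minus xi1 xi2))
  (h : R) (hh : 0 < h) (Omega omega : R)
  (hOmega : 1 <= Omega) (homega : 0 < omega < 1)
  (hpower : forall n : nat,
     op_norm (fun x : X => Nat.iter n (Delta_op j T T1 B F h) x)
       <= Omega * omega ^ n)
  (eps : R) (heps : 0 <= eps) :
  let c1 := sup_op_norm (Delta_op j T T1 B F) h in
  let c2 := sup_op_norm T h in
  let c3 := sup_op_norm (SF_op j T1 B F) h in
  eps * Omega * (op_norm (SF_op j T1 B F h) + c3 * (exp (c2 * L * h) - 1))
    < 1 - omega - c1 * Omega * (exp (c2 * L * h) - 1) ->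
  forall lmax : nat, (1 <= lmax)%nat ->
    exponentially_stable j T T1 B F phi h eps lmax.
Proof.
  intros c1 c2 c3 Hsmall lmax Hlmax.
  pose (XR := realify X).
  pose (S := SF_op j T1 B F : R -> XR -> XR).
  pose (D := fun t (x : XR) => plus (T t x) (S t x) : XR).
  assert (HT : C0_semigroup (V := XR) T) by exact (C0_realify T (proj1 hA)).
  assert (HS : is_input_map (V := XR) T S).
  { exact (SF_op_input_map A T hA lambda hlambda j hX1 T1 hT1 B hB F (proj1 hF)). }
  destruct (C0_bounded (V := XR) T HT h) as [M2 [HM2 HTb]].
  destruct (input_bounded (V := XR) T S HS h) as [M3 [HM3 HSb]].
  assert (HDlin : forall t, 0 <= t -> is_linear (U := XR) (V := XR) (D t)).
  { intros t Ht.
    exact (is_linear_comp _ _ (is_linear_prod _ _ (C0_linear (V := XR) T HT t Ht)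
      (input_linear (V := XR) T S HS t Ht)) is_linear_plus). }
  assert (HDb : forall t (x : XR), 0 <= t <= h ->
    norm (D t x) <= (M2 + M3) * norm x).
  { intros t x Ht. eapply Rle_trans; [apply (norm_triangle (V := XR)) |].
    rewrite Rmult_plus_distr_r. apply Rplus_le_compat; auto. }
  destruct (sup_op_norm_bounds (V := XR) (W := XR) D h (M2 + M3))
    as [Hc1 HD1]; [lra | lra | intros t Ht; apply HDlin; lra | exact HDb |].
  destruct (sup_op_norm_bounds (V := XR) (W := XR) T h M2)
    as [Hc2 HT2]; [lra | lra | intros t Ht; apply (C0_linear (V := XR) T HT); lra | exact HTb |].
  destruct (sup_op_norm_bounds (V := XR) (W := XR) S h M3)
    as [Hc3 HS3]; [lra | lra | intros t Ht; apply (input_linear (V := XR) T S HS); lra | exact HSb |].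
  destruct (op_norm_bounds (V := XR) (W := XR) (S h) M3)
    as [[Hs _] HSh]; [apply (input_linear (V := XR) T S HS); lra | lra
                     | intros x; apply HSb; lra |].
  assert (Hpow : forall n (x : XR),
    norm (Nat.iter n (D h) x) <= Omega * omega ^ n * norm x).
  { intros n x.
    assert (Hlin : is_linear (U := XR) (V := XR) (fun x => Nat.iter n (D h) x)).
    { induction n as [| n IH]; [exact is_linear_id |].
      exact (is_linear_comp _ _ IH (HDlin h (Rlt_le _ _ hh))). }
    destruct (linear_norm _ Hlin) as [M [HM HMn]].
    destruct (op_norm_bounds _ M Hlin (Rlt_le _ _ HM) HMn) as [_ H].
    eapply Rle_trans; [apply H |].
    apply Rmult_le_compat_r; [apply norm_ge_0 | exact (hpower n)]. }
  assert (Hom : 0 < omega) by apply homega.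
  pose (N := adapted_norm (V := XR) (D h) omega).
  assert (Hrho : omega + c1 * Omega * (exp (c2 * L * h) - 1)
    + eps * Omega * (op_norm (SF_op j T1 B F h) + c3 * (exp (c2 * L * h) - 1)) < 1)
    by lra.
  destruct (sampled_loop_decay (V := XR) T S HT HS phi L hL hphi0 hphi h hh
    c1 c2 c3 Hc1 Hc2 Hc3 HD1 HT2 HS3 (op_norm (SF_op j T1 B F h)) eps omega Omega
    heps Hom hOmega Hs HSh N
    (norm_le_adapted (V := XR) (D h) Omega omega Hom Hpow)
    (adapted_norm_le (V := XR) (D h) Omega omega Hom Hpow)
    (adapted_norm_triangle (V := XR) (D h) (HDlin h (Rlt_le _ _ hh)) Omega omega Hom Hpow)
    (adapted_norm_contraction (V := XR) (D h) Omega omega Hom Hpow)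
    Hrho lmax Hlmax) as [Gamma [gamma [HGamma [Hgamma Hdecay]]]].
  exists Gamma, gamma. split; [exact HGamma |]. split; [exact Hgamma |].
  intros x0 x [Hxc [Hx0 [t [Ht0 [Hnext Hheld]]]]] tau Htau.
  rewrite <- Hx0.
  refine (Hdecay x t Ht0 _ tau Htau). clear tau Htau.
  assert (Hmild : forall (y : R -> X) s a, continuous_on (fun r => s <= r) y ->
    (forall tau, 0 < tau <= a -> held_input_formula j T T1 B F phi y s tau) ->
    mild_trajectory (V := XR) T S phi (y s) (y s) (fun r => y (s + Rmax 0 r)) a).
  { intros y s a Hy Hf.
    pose proof (continuous_on_Rmax_0 y s Hy) as Hyc.
    split; [exact Hyc |]. intros r Hr. rewrite Rmax_right by lra.
    destruct (Req_dec r 0) as [-> | Hr0].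
    - rewrite Rplus_0_r. symmetry.
      exact (mild_formula_at_0 (V := XR) T S HT HS _ _ _).
    - apply (held_input_formula_mild A T hA lambda hlambda j hX1 T1 hT1 B F).
      + intros r'. apply (lipschitz_continuous_comp (V := XR) phi L hL hphi
          (fun r => y (s + Rmax 0 r))), Hyc.
      + lra.
      + apply Hf. lra. }
  assert (Hm : forall n, exists m, t n = INR m * h).
  { induction n as [| n [m Hm]]; [exists 0%nat; rewrite Ht0; simpl; ring |].
    pose proof (Hnext n) as Hn. rewrite Hm in Hn.
    apply next_update_sampled in Hn; [| assumption | assumption].
    destruct Hn as [p [z [_ [E _]]]]. exists (m + p)%nat. rewrite E, plus_INR. ring. }
  intros n. destruct (Hm n) as [m Etn]. pose proof (Hnext n) as Hn.
  rewrite Etn in Hn at 1.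
  apply next_update_sampled in Hn; [| assumption | assumption].
  destruct Hn as [p [z [Hp [E [Hz Hquiet]]]]]. rewrite <- Etn in *.
  assert (Htn : 0 <= t n).
  { rewrite Etn. apply Rmult_le_pos; [apply pos_INR | lra]. }
  assert (Hx : mild_trajectory (V := XR) T S phi (x (t n)) (x (t n))
    (fun r => x (t n + Rmax 0 r)) (INR p * h)).
  { apply Hmild.
    - intros s Hts P HP. generalize (Hxc s ltac:(lra) P HP).
      unfold filtermap, within. apply filter_imp.
      intros r Hr Hsr. apply Hr. lra.
    - intros tau Htau. apply Hheld. rewrite E. lra. }
  destruct Hz as [Hzc [Hz0 Hzf]].
  assert (Hzm : mild_trajectory (V := XR) T S phi (x (t n)) (x (t n))
    (fun r => z (t n + Rmax 0 r)) (INR p * h)).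
  { rewrite <- Hz0. apply Hmild; [exact Hzc |]. intros tau Htau. apply Hzf. lra. }
  exists p. split; [exact Hp |]. split; [exact E |]. split; [exact Hx |].
  intros q Hq. destruct (Nat.eq_dec q 0) as [-> | Hq0].
  - simpl. rewrite Rmult_0_l, Rplus_0_r.
    eapply Rle_trans; [right; apply (norm_minus_self (V := XR)) |].
    apply Rmult_le_pos; [exact heps | apply (norm_ge_0 (V := XR))].
  - assert (Hqh : 0 <= INR q * h <= INR p * h).
    { split; [apply Rmult_le_pos; [apply pos_INR | lra] |].
      apply Rmult_le_compat_r; [lra |]. apply le_INR. lia. }
    (* The quiet samples are those of [z]; they are transferred to [x]. *)
    pose proof (mild_unique (V := XR) T S HT phi L hL hphi _ _ _ _ _ Hx Hzm _ Hqh) as Exz.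
    cbv beta in Exz. rewrite Rmax_right in Exz by lra. rewrite Exz.
    eapply Rle_trans; [right; apply (norm_minus_sym (V := XR)) |].
    apply Hquiet. lia.
Qed.
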